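(* Consider the closed-loop, watermarked LTI system under sensor attack described in the context. Suppose $(A,B)$ is stabilizable, $(A,C)$ is detectable, $\Sigma_E$ is full rank, and $k' = \min\{k\geq 0 \mid C(A+BK)^kB \neq 0\}$ exists. If $$\operatorname{as-lim}_{N\to\infty} \frac{1}{N}\sum_{n=0}^{N-1} (C\hat{x}_n-y_n)(C\hat{x}_n-y_n)^{\mathsf T} = C\Sigma_\Delta C^{\mathsf T}+\Sigma_Z$$ and $$\operatorname{as-lim}_{N\to\infty} \frac{1}{N}\sum_{n=0}^{N-1} (C\hat{x}_n - y_n)\, e_{n-k'-1}^{\mathsf T} = 0,$$ then $$\operatorname{as-lim}_{N\to\infty} \frac{1}{N}\sum_{n=0}^{N-1} v_n^{\mathsf T}v_n = 0,$$ meaning that $v_n$ asymptotically has zero power.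
   Context: Notation: $\operatorname{as-lim}$ denotes the almost sure limit. A real square matrix is Schur stable if all its eigenvalues lie strictly inside the unit disk. Plant: $x_{n+1} = Ax_n + Bu_n + w_n$, $y_n = Cx_n + z_n + v_n$ for $n\ge 0$, with $x_n\in\mathbb{R}^p$, $u_n\in\mathbb{R}^q$, $y_n,z_n,v_n\in\mathbb{R}^m$, and real matrices $A\in\mathbb{R}^{p\times p}$, $B\in\mathbb{R}^{p\times q}$, $C\in\mathbb{R}^{m\times p}$. The process noise $w_n$ is i.i.d. zero-mean jointly Gaussian with covariance $\Sigma_W$; the measurement noise $z_n$ is i.i.d. zero-mean jointly Gaussian with covariance $\Sigma_Z$; the processes $(w_n)$ and $(z_n)$ are independent. The $v_n$ is an additive measurement disturbance inserted by an attacker. Controller: $K\in\mathbb{R}^{q\times p}$ and $L\in\mathbb{R}^{p\times m}$ are constant matrices such that $A+BK$ and $A+LC$ are Schur stable. The input is $u_n = K\hat{x}_n + e_n$, where $e_n$ (the private excitation, or watermark) is i.i.d. zero-mean Gaussian in $\mathbb{R}^q$ with covariance $\Sigma_E$, and $\hat{x}_n\in\mathbb{R}^p$ is the observer state, $\hat{x}_{n+1} = (A+BK+LC)\hat{x}_n + Be_n - Ly_n$. Attack model: $v_n = \alpha(Cx_n + z_n) + C\xi_n + \zeta_n$ for some fixed $\alpha\in\mathbb{R}$, where $\xi_{n+1} = (A+BK)\xi_n + \omega_n$ with $\xi_n\in\mathbb{R}^p$, $\zeta_n$ are i.i.d. zero-mean Gaussian with covariance $\Sigma_S$, and $\omega_n$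 are i.i.d. zero-mean Gaussian with covariance $\Sigma_O$. The processes $(w_n),(z_n),(e_n),(\zeta_n),(\omega_n)$ are mutually independent, and the initial values $x_0,\hat{x}_0,\xi_0$ are deterministic. Terms $e_j$ with $j<0$ are taken to be $0$. $\Sigma_\Delta$ is the positive semidefinite solution of the Lyapunov equation $\Sigma_\Delta = (A+LC)\Sigma_\Delta(A+LC)^{\mathsf T} + \Sigma_W + L\Sigma_ZL^{\mathsf T}$. *)

(* Defs.v *)
From mathcomp Require Import all_boot all_order all_algebra.
From mathcomp Require Import complex.
From mathcomp Require Import all_classical all_reals all_analysis.

Set Implicit Arguments.
Unset Strict Implicit.
Unset Printing Implicit Defensive.

Import Order.TTheory GRing.Theory Num.Theory.
Import numFieldNormedType.Exports.

Local Open Scope classical_set_scope.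
Local Open Scope ring_scope.

Definition schur_stable (R : realType) (n : nat) (M : 'M[R]_n) : Prop :=
  forall z : R[i], eigenvalue (map_mx (real_complex R) M) z -> `|z| < 1.

Definition stabilizable (R : realType) (p q : nat)
    (A : 'M[R]_p) (B : 'M[R]_(p, q)) : Prop :=
  exists K : 'M[R]_(q, p), schur_stable (A + B *m K).

Definition detectable (R : realType) (p m : nat)
    (A : 'M[R]_p) (C : 'M[R]_(m, p)) : Prop :=
  exists L : 'M[R]_(p, m), schur_stable (A + L *m C).

Definition posdef_semi (R : realType) (n : nat) (M : 'M[R]_n) : Prop :=
  M^T = M /\ forall x : 'cV[R]_n, 0 <= (x^T *m M *m x) 0 0.

(* [normal_prob m 0] is a junk law in the library; a normal law of standard
   deviation 0 is the point mass at its mean, as is needed to allow singular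
   covariance matrices. *)
Definition normal_law (R : realType) (m s : R) (U : set R) : \bar R :=
  if s == 0 then \d_m U else normal_prob m s U.

Definition random_vector (d : measure_display) (T : measurableType d)
    (R : realType) (n : nat) (X : T -> 'cV[R]_n) : Prop :=
  forall i : 'I_n, measurable_fun [set: T] (fun t => X t i 0).

(* Every linear combination of the coordinates is univariate normal. *)
Definition jointly_gaussian (d : measure_display) (T : measurableType d)
    (R : realType) (P : probability T R) (n : nat) (X : T -> 'cV[R]_n) : Prop :=
  random_vector X /\
  forall a : 'cV[R]_n, exists m s : R, 0 <= s /\
    forall U : set R, measurable U ->
      P ((fun t => (a^T *m X t) 0 0) @^-1` U) = normal_law m s U.

Definition centered_gaussian (d : measure_display) (T : measurableType d)
    (R : realType) (P : probability T R) (n : nat)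
    (S : 'M[R]_n) (X : T -> 'cV[R]_n) : Prop :=
  [/\ jointly_gaussian P X,
      forall i : 'I_n, ('E_P[(fun t => X t i 0)%R] = 0)%E &
      forall i j : 'I_n,
        covariance P (fun t => X t i 0) (fun t => X t j 0) = (S i j)%:E].

Definition sigma_vec (d : measure_display) (T : measurableType d)
    (R : realType) (n : nat) (X : T -> 'cV[R]_n) : set (set T) :=
  <<s \bigcup_(i in [set: 'I_n])
        preimage_set_system [set: T] (fun t => X t i 0) measurable >>.

Definition sigma_process (d : measure_display) (T : measurableType d)
    (R : realType) (n : nat) (X : nat -> T -> 'cV[R]_n) : set (set T) :=
  <<s \bigcup_(k in [set: nat]) sigma_vec (X k) >>.

Definition mutually_independent (d : measure_display) (T : measurableType d)
    (R : realType) (P : probability T R) (I : choiceType)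
    (F : I -> set (set T)) : Prop :=
  forall (s : seq I) (E : I -> set T), uniq s ->
    (forall i, i \in s -> F i (E i)) ->
    P (\bigcap_(i in [set` s]) E i) = (\prod_(i <- s) P (E i))%E.

(* The common law is N(0, S), so "identically distributed" needs no separate
   clause. *)
Definition iid_centered_gaussian (d : measure_display) (T : measurableType d)
    (R : realType) (P : probability T R) (n : nat)
    (S : 'M[R]_n) (X : nat -> T -> 'cV[R]_n) : Prop :=
  (forall k : nat, centered_gaussian P S (X k)) /\
  mutually_independent P (fun k : nat => sigma_vec (X k)).

Definition as_lim (d : measure_display) (T : measurableType d)
    (R : realType) (P : probability T R) (V : topologicalType)
    (X : nat -> T -> V) (l : V) : Prop :=
  {ae P, forall t, (fun N => X N t) @ \oo --> l}.

Definition time_avg (R : realType) (T : Type) (m n : nat)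
    (X : nat -> T -> 'M[R]_(m, n)) (N : nat) (t : T) : 'M[R]_(m, n) :=
  N%:R^-1 *: \sum_(0 <= k < N) X k t.

(* X_(n - k), with the convention X_j = 0 for j < 0. *)
Definition delay (R : realType) (T : Type) (m : nat) (k : nat)
    (X : nat -> T -> 'cV[R]_m) (n : nat) (t : T) : 'cV[R]_m :=
  if (k <= n)%N then X (n - k)%N t else 0.

(* Main.v *)
(* Writing the residual as r_n = C xh_n - y_n and j = n - k' - 1, the watermark
   e_j enters r_n only through - alpha C (A + BK)^k' B e_j, because the observer
   error does not see the watermark until the attack feeds it back and the
   Markov parameters below k' vanish.  The first test bounds the power of r
   almost surely, so a truncated martingale law of large numbers applies even
   when the attacked loop is unstable; the second test then forces
   alpha C (A + BK)^k' B Sigma_E = 0, hence alpha = 0.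

   With alpha = 0 the observer error splits into the attack-free part d1 and a
   part d2 driven by v, and r = (C d1 - z) + s with s = C d2 - v.  The two
   summands are asymptotically uncorrelated and C d1 - z alone already has the
   covariance of the first test, so s has zero power.  Correlating s with zeta
   gives Sigma_S = 0.  Since d2 also satisfies d2' = A d2 + L s, it is
   uncorrelated with all past values of omega, so correlating s with past values
   of omega gives C (A + BK)^k Sigma_O = 0 for every k, and v = C xi + zeta has
   zero power.

   Stability is used through Cayley-Hamilton: factoring the characteristic
   polynomial over the complex numbers reduces a stable vector recursion to a
   chain of contractive scalar ones. *)
From HB Require Import structures.
Require Import Defs.
From mathcomp Require Import all_boot all_order all_algebra.
From mathcomp Require Import complex.
From mathcomp Require Import all_classical all_reals all_analysis measurable_realfun.
From mathcomp Require Import ring lra zify.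

Set Implicit Arguments.
Unset Strict Implicit.
Unset Printing Implicit Defensive.

Import Order.TTheory GRing.Theory Num.Theory.
Import numFieldNormedType.Exports.

Local Open Scope classical_set_scope.
Local Open Scope ring_scope.

(** * Independence *)

(** No moment of the residual is available: while [alpha] may be nonzero the loop can be unstable,
    and the first test bounds the power only on almost every path, with a constant that depends on
    the path. So the law of large numbers is proved for multipliers that are merely predictable,
    with the power bound as a premise on the single path. It runs along the squares [k ^ 2], where
    variances of order [1 / k ^ 2] are summable, and the blocks between squares are filled by
    Cauchy-Schwarz. Averages of products of noise coordinates need finite variances too, hence the
    fourth moments of normal laws. Countably many almost sure events are collected; then one sample
    path is fixed and the rest is linear algebra on limits of averages. That stable recursions have
    limiting correlations is proved, not assumed: shifting both signals by one step changes an
    average only by a boundary term, so the average nearly solves a Lyapunov equation, whose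
    operator is invertible. This boundary term is why energies must be [o(n)] besides having bounded
    averages. *)

Section independence.
Context (d : measure_display) (T : measurableType d) (R : realType)
  (P : probability T R) (I : finType) (G : I -> nat -> set (set T)).
Hypothesis Gsigma : forall i k, sigma_algebra setT (G i k).
Hypothesis Gmeas : forall i k, G i k `<=` measurable.
Hypothesis Gin : forall i, mutually_independent P (G i).
Hypothesis Gout : mutually_independent P
  (fun i => <<s \bigcup_(k in [set: nat]) G i k >>).

Definition sigma_family (S : set (I * nat)) : set (set T) :=
  <<s \bigcup_(j in S) G j.1 j.2 >>.

(** Independence comes in two layers. A finite intersection of events of one source lies in the
    sigma-algebra of that source, so [Gout] separates the sources; [Gin] then separates the times
    within each. *)
Lemma prob_bigcap_family (E : I -> nat -> set T) (N : nat) :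
  (forall i k, G i k (E i k)) ->
  P (\bigcap_i \bigcap_(k in `I_N) E i k) = (\prod_i \prod_(k < N) P (E i k))%E.
Proof.
move=> GE.
have iotaE : [set` iota 0 N] = `I_N.
  by apply/seteqP; split=> k /=; rewrite mem_iota add0n.
have H i : P (\bigcap_(k in `I_N) E i k) = (\prod_(k < N) P (E i k))%E.
  rewrite -iotaE (@Gin i _ (E i) (iota_uniq 0 N)) => [|k _]; last exact: GE.
  by rewrite -[N in iota _ N]subn0 big_mkord.
have IE : [set` index_enum I] = setT.
  by apply/seteqP; split=> i // _ /=; exact: mem_index_enum.
rewrite -IE.
rewrite (@Gout _ (fun i => \bigcap_(k in `I_N) E i k) (index_enum_uniq I)) => [|i _];
  first by apply: eq_bigr => i _.
pose U := g_sigma_algebraType (\bigcup_(k in [set: nat]) G i k).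
apply: (@bigcap_measurableType _ U) => k _; apply: sub_sigma_algebra.
by exists k; last exact: GE.
Qed.

(** Cylinder events: a pi-system generating [sigma_family S]. Padding with [setT] off [S] leaves
    every other coordinate free to receive one more event. *)
Let cyl (S : set (I * nat)) : set (set T) := [set A | exists E N,
  [/\ forall i k, G i k (E i k),
      forall i k, ~ (S (i, k) /\ (k < N)%N) -> E i k = setT &
      A = \bigcap_i \bigcap_k E i k]].

Let GT i k : G i k setT.
Proof. by case: (Gsigma i k) => G0 GC _; have := GC _ G0; rewrite setD0. Qed.

Let GI i k A B : G i k A -> G i k B -> G i k (A `&` B).
Proof.
by move=> GA GB; have [_ _ _ sI] := (sigma_algebraP (fun X _ => @subsetT _ X)).1
  (Gsigma i k); exact: sI.
Qed.

Let cyl_setI S : setI_closed (cyl S).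
Proof.
move=> _ _ [E [N [GE E1 ->]]] [F [M [GF F1 ->]]].
exists (fun i k => E i k `&` F i k), (maxn N M); split.
- by move=> i k; exact: GI.
- move=> i k Sik; rewrite E1 ?F1 ?setTI// => -[Si kM]; apply: Sik; split=> //;
    by rewrite leq_max kM ?orbT.
- apply/seteqP; split=> t.
    by move=> [tE tF] i _ k _; split; [exact: tE|exact: tF].
  by move=> tEF; split=> i _ k _; have [] := tEF i Logic.I k Logic.I.
Qed.

Let prob_cyl E N : (forall i k, G i k (E i k)) ->
    (forall i k, ~ (k < N)%N -> E i k = setT) ->
  P (\bigcap_i \bigcap_k E i k) = (\prod_i \prod_(k < N) P (E i k))%E.
Proof.
move=> GE E1; rewrite -prob_bigcap_family//; congr (P _).
apply: eq_bigcapr => i _; apply/seteqP; split=> t tE k kN; first exact: tE.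
by have [kN'|kN'] := pselect (k < N)%N; [exact: tE|rewrite E1].
Qed.

(** Uniqueness of finite measures on a pi-system: the measures sending [A] to [P (A & B)] and to
    [P B * P A] agree on cylinders. *)
Lemma sigma_family_indep (S : set (I * nat)) i0 k0 A B : ~ S (i0, k0) ->
  sigma_family S A -> G i0 k0 B -> (P (A `&` B) = P A * P B)%E.
Proof.
move=> S0 SA GB.
have mB := Gmeas GB.
have cylm : cyl S `<=` measurable.
  move=> _ [E [N [GE _ ->]]]; apply: fin_bigcap_measurable => // i _.
  by apply: bigcap_measurableType => k _; exact: Gmeas.
have Gcyl : \bigcup_(j in S) G j.1 j.2 `<=` cyl S.
  move=> X [[i k] /= Sik GX].
  exists (fun i' k' => if (i', k') == (i, k) then X else setT), k.+1; split.
  - by move=> i' k'; case: eqP => [[-> ->]|].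
  - by move=> i' k'; case: eqP => // -[-> ->] [].
  - apply/seteqP; split=> t; first by move=> Xt i' _ k' _; case: eqP.
    by move=> /(_ i Logic.I k Logic.I); rewrite eqxx.
have sA : <<s cyl S >> A by apply: sub_sigma_algebra2 SA; exact: Gcyl.
pose c : {nonneg R} := NngNum (fine_ge0 (measure_ge0 P B)).
have cE X : mscale c P X = (P X * P B)%E.
  rewrite /mscale muleC; congr (_ * _)%E.
  by apply: fineK; exact: fin_num_measure.
pose m1 : {measure set T -> \bar R} := mrestr P mB.
pose m2 : {measure set T -> \bar R} := mscale c P.
suff : m1 A = m2 A by rewrite /m1 /m2 /= cE.
apply: (@g_sigma_algebra_measure_unique _ _ _ (cyl S) cylm (fun=> setT)) => //.
- move=> _; exists (fun _ _ => setT), 0%N; split=> //.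
  by apply/seteqP; split.
- by apply/seteqP; split=> // t _; exists 0%N.
- move=> _ [E [N [GE E1 ->]]]; rewrite /m1 /m2/= cE /mrestr.
  (* As [(i0, k0)] is outside [S], [E] is [setT] there; intersecting the cylinder with [B] just
     fills this free slot. *)
  pose E' i k := if (i, k) == (i0, k0) then B else E i k.
  have GE' i k : G i k (E' i k) by rewrite /E'; case: eqP => [[-> ->]|].
  pose M := maxn N k0.+1.
  have EM i k : ~ (k < M)%N -> E i k = setT.
    move=> kM; apply: E1 => -[_ kN]; apply: kM.
    by rewrite (leq_trans kN)// leq_maxl.
  have k0M : (k0 < M)%N by rewrite leq_maxr.
  have -> : \bigcap_i \bigcap_k E i k `&` B = \bigcap_i \bigcap_k E' i k.
    apply/seteqP; split=> t.
      by move=> [tE tB] i _ k _; rewrite /E'; case: eqP => // _; exact: tE.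
    move=> tE'; split; last by have := tE' i0 Logic.I k0 Logic.I; rewrite /E' eqxx.
    move=> i _ k _; have := tE' i Logic.I k Logic.I; rewrite /E'.
    by case: eqP => // -[-> ->] _; rewrite E1// => -[].
  rewrite (prob_cyl _ EM)// (@prob_cyl E' M)//; last first.
    move=> i k kM; rewrite /E'; case: eqP => [[_ kk]|_]; last exact: EM.
    by rewrite kk in kM.
  rewrite (bigD1 i0)//= [in RHS](bigD1 i0)//=.
  rewrite (bigD1 (Ordinal k0M))//= [in RHS](bigD1 (Ordinal k0M))//=.
  rewrite {1}/E' eqxx (E1 i0 k0); last by case.
  rewrite probability_setT mul1e -muleA muleC; congr (_ * _ * _)%E.
    apply: eq_bigr => k; rewrite -val_eqE/= => kk0.
    by rewrite /E' xpair_eqE eqxx/= (negbTE kk0).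
  apply: eq_bigr => i ii0; apply: eq_bigr => k _.
  by rewrite /E' xpair_eqE (negbTE ii0).
- by move=> k; rewrite /m1/= /mrestr setTI (le_lt_trans (probability_le1 P mB)) ?ltry.
Qed.

End independence.

(** * Fubini for two independent random variables *)

Section independent_pair.
Context (d d1 d2 : measure_display) (T : measurableType d)
  (T1 : measurableType d1) (T2 : measurableType d2) (R : realType)
  (P : probability T R).
Local Open Scope ereal_scope.

Definition independent_rv (X : T -> T1) (Y : T -> T2) :=
  forall (U : set T1) (V : set T2), measurable U -> measurable V ->
  P (X @^-1` U `&` Y @^-1` V) = P (X @^-1` U) * P (Y @^-1` V).

Variables (X : {mfun T >-> T1}) (Y : {mfun T >-> T2}).
Hypothesis XY : independent_rv X Y.

Let mZ : measurable_fun setT (fun t => (X t, Y t)).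
Proof. exact: measurable_fun_pair. Qed.
Let Z : {mfun T >-> (T1 * T2)%type} := mfun_Sub (mem_set mZ).

(** Independence is equality of the two measures on rectangles, and rectangles determine the product
    measure. *)
Let joint_law A : measurable A ->
  (distribution P X \x distribution P Y) A = distribution P Z A.
Proof.
move=> mA; apply: product_measure_unique => // U V mU mV; exact: XY.
Qed.

Let integral_joint (f : T1 * T2 -> \bar R) : measurable_fun [set: T1 * T2] f ->
    (forall z, 0 <= f z) ->
  \int[distribution P X \x distribution P Y]_z f z = \int[P]_t f (X t, Y t).
Proof.
move=> mf f0; rewrite -(ge0_integral_distribution Z)//.
by apply: eq_measure_integral => A mA _; exact: joint_law.
Qed.

Lemma ge0_integral_independent_pair (f : T1 * T2 -> \bar R) :
    measurable_fun [set: T1 * T2] f -> (forall z, 0 <= f z) ->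
  \int[P]_t f (X t, Y t) =
  \int[distribution P X]_x \int[distribution P Y]_y f (x, y).
Proof. by move=> mf f0; rewrite -integral_joint// fubini_tonelli1. Qed.

Lemma integral_independent_pair (f : T1 * T2 -> \bar R) :
    measurable_fun [set: T1 * T2] f -> P.-integrable setT (fun t => f (X t, Y t)) ->
  \int[P]_t f (X t, Y t) =
  \int[distribution P X]_x \int[distribution P Y]_y f (x, y).
Proof.
move=> mf iXY.
transitivity (\int[distribution P X \x distribution P Y]_z f z).
  rewrite -(@integral_distribution _ _ _ _ _ _ Z f)//.
  by apply: eq_measure_integral => A mA _; exact/esym/joint_law.
rewrite -integral12_prod_meas1//.
apply/integrableP; split => //.
rewrite integral_joint//; last exact: measurableT_comp.
by have /integrableP[_] := iXY.
Qed.

End independent_pair.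

Section product_expectation.
Context (d : measure_display) (T : measurableType d) (R : realType)
  (P : probability T R).
Local Open Scope ereal_scope.
Implicit Types X Y : T -> R.

Let RM := measurableTypeR R.

Lemma independent_rv_comp X Y (f g : R -> R) :
  measurable_fun setT f -> measurable_fun setT g ->
  independent_rv P X Y -> independent_rv P (f \o X) (g \o Y).
Proof.
move=> mf mg XY U V mU mV.
apply: (XY (f @^-1` U) (g @^-1` V)); rewrite -[X in measurable X]setTI.
  exact: mf.
exact: mg.
Qed.

Lemma ge0_expectation_indepM X Y :
  measurable_fun setT X -> measurable_fun setT Y -> independent_rv P X Y ->
  (forall t, 0 <= X t)%R -> (forall t, 0 <= Y t)%R ->
  \int[P]_t (X t * Y t)%:E = \int[P]_t (X t)%:E * \int[P]_t (Y t)%:E.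
Proof.
move=> mX mY XY X0 Y0.
pose X' : {mfun T >-> RM} := @mfun_Sub _ _ T RM X (mem_set mX).
pose Y' : {mfun T >-> RM} := @mfun_Sub _ _ T RM Y (mem_set mY).
have mabsE : measurable_fun setT (fun y : RM => `|y|%:E).
  by apply/measurable_EFinP.
(* The product is known to be nonnegative only on the range of [(X, Y)]; absolute values make the
   integrand nonnegative on the whole plane, as Tonelli asks. *)
transitivity (\int[P]_t (`|X' t|%:E * `|Y' t|%:E)).
  by apply: eq_integral => t _; rewrite -EFinM !ger0_norm.
rewrite (@ge0_integral_independent_pair _ _ _ _ _ _ _ _ X' Y' XY
  (fun z => `|z.1|%:E * `|z.2|%:E))//=.
- under eq_integral => x _.
    rewrite ge0_integralZl//.
    rewrite ge0_integral_distribution//.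
    over.
  rewrite ge0_integralZr//; last first.
    by apply: integral_ge0 => t _; rewrite lee_fin.
  rewrite ge0_integral_distribution//.
  by congr (_ * _); apply: eq_integral => t _ /=; rewrite ger0_norm.
- by apply: emeasurable_funM; apply/measurable_EFinP/measurableT_comp => //.
Qed.

(** By Fubini the inner integral is [x] times the mean of [Y], hence zero for each [x];
    integrability of the product suffices, without that of [X]. *)
Lemma expectation_indepM0 X Y :
  measurable_fun setT X -> measurable_fun setT Y -> independent_rv P X Y ->
  P.-integrable setT (fun t => (X t * Y t)%:E) ->
  P.-integrable setT (EFin \o Y) -> \int[P]_t (Y t)%:E = 0 ->
  \int[P]_t (X t * Y t)%:E = 0.
Proof.
move=> mX mY XY iXY iY EY0.
pose X' : {mfun T >-> RM} := @mfun_Sub _ _ T RM X (mem_set mX).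
pose Y' : {mfun T >-> RM} := @mfun_Sub _ _ T RM Y (mem_set mY).
rewrite (@integral_independent_pair _ _ _ _ _ _ _ _ X' Y' XY
  (fun z => (z.1 * z.2)%:E))//=.
  apply: integral0_eq => x _.
  under eq_integral do rewrite EFinM.
  have mid : measurable_fun [set: RM] (EFin \o id) by exact/measurable_EFinP.
  rewrite (@integralZl _ _ _ (distribution P Y') _ _ (EFin \o id))//=.
    by rewrite (@integral_distribution _ _ _ _ _ _ Y' (EFin \o id))//= EY0 mule0.
  by apply: integrable_pushforward => //; exact: measurable_funPT.
by apply/measurable_EFinP/measurable_funM.
Qed.

End product_expectation.

(** * Square integrable variables and one martingale step *)

Section square_integrable.
Context (d : measure_display) (T : measurableType d) (R : realType)
  (P : probability T R).
Local Open Scope ereal_scope.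
Implicit Types X Y s e : T -> R.

Definition square_integrable X :=
  measurable_fun setT X /\ \int[P]_t (X t ^+ 2)%:E < +oo.

Lemma square_integrable_sqr X : square_integrable X ->
  P.-integrable setT (fun t => (X t ^+ 2)%:E).
Proof.
move=> [mX X2]; apply/integrableP; split.
  by apply/measurable_EFinP/measurable_funX.
by under eq_integral do rewrite gee0_abs ?lee_fin ?sqr_ge0//.
Qed.

Lemma square_integrableM X Y : square_integrable X -> square_integrable Y ->
  P.-integrable setT (fun t => (X t * Y t)%:E).
Proof.
move=> X2 Y2.
have := integrableD measurableT (square_integrable_sqr X2) (square_integrable_sqr Y2).
apply: le_integrable => //.
  by apply/measurable_EFinP/measurable_funM; [case: X2|case: Y2].
move=> t _; rewrite -EFinD !abse_EFin lee_fin [leRHS]ger0_norm ?addr_ge0 ?sqr_ge0//.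
rewrite normrM -(real_normK (num_real (X t))) -(real_normK (num_real (Y t))).
have := normr_ge0 (X t); have := normr_ge0 (Y t).
by nra.
Qed.

Lemma square_integrable_bounded X (c : R) : measurable_fun setT X ->
  (forall t, `|X t| <= c)%R -> square_integrable X.
Proof.
move=> mX Xc; split => //.
apply: (@le_lt_trans _ _ (\int[P]_t (c ^+ 2)%:E)).
  apply: ge0_le_integral => //.
  - by move=> t _; rewrite lee_fin sqr_ge0.
  - by apply/measurable_EFinP/measurable_funX.
  - move=> t _; rewrite lee_fin -(real_normK (num_real (X t))).
    by rewrite lerXn2r ?nnegrE// (le_trans _ (Xc t)).
by rewrite integral_cst//= probability_setT mule1 ltry.
Qed.

Lemma square_integrable_integrable X : square_integrable X ->
  P.-integrable setT (EFin \o X).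
Proof.
move=> X2; have c1 : square_integrable (cst 1%R).
  by apply: (@square_integrable_bounded _ 1%R) => // t; rewrite normr1.
have := square_integrableM X2 c1; apply: eq_integrable => // t _.
by rewrite /= mulr1.
Qed.

(** Pythagoras for one step of a martingale transform: the cross term is the mean of [(X s) e], zero
    because [X s] is independent of the centred [e]. The bound [c] serves integrability only and
    does not enter the estimate. *)
Lemma expectation_sqr_increment X s e (c v : R) :
  square_integrable X -> measurable_fun setT s -> (forall t, `|s t| <= c)%R ->
  square_integrable e ->
  independent_rv P (X \* s)%R e -> independent_rv P s e ->
  \int[P]_t (e t)%:E = 0 -> \int[P]_t (e t ^+ 2)%:E <= v%:E ->
  square_integrable (X \+ s \* e)%R /\
  \int[P]_t ((X t + s t * e t) ^+ 2)%:E <=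
    \int[P]_t (X t ^+ 2)%:E + v%:E * \int[P]_t (s t ^+ 2)%:E.
Proof.
move=> X2 ms sc e2 Xse se e0 ev.
have [mX X2oo] := X2; have [me e2oo] := e2.
have s2 : square_integrable s := square_integrable_bounded ms sc.
have v0 : (0 <= v)%R.
  by rewrite -lee_fin (le_trans _ ev)//; apply: integral_ge0 => t _; rewrite lee_fin sqr_ge0.
have Ese : \int[P]_t ((s t * e t) ^+ 2)%:E <= v%:E * \int[P]_t (s t ^+ 2)%:E.
  under eq_integral do rewrite exprMn.
  rewrite (@ge0_expectation_indepM _ _ _ _ (fun t => s t ^+ 2)%R (fun t => e t ^+ 2)%R).
  - rewrite muleC lee_wpmul2r//; apply: integral_ge0 => t _; rewrite lee_fin sqr_ge0//.
  - exact: measurable_funX.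
  - exact: measurable_funX.
  - apply: (@independent_rv_comp _ _ _ _ s e (fun x => x ^+ 2)%R (fun x => x ^+ 2)%R) => //;
      exact: measurable_funX.
  - by move=> t; rewrite sqr_ge0.
  - by move=> t; rewrite sqr_ge0.
have se2 : square_integrable (s \* e)%R.
  split; first exact: measurable_funM.
  apply: le_lt_trans Ese _; apply: lte_mul_pinfty; rewrite ?lee_fin//.
  by have [] := s2.
have iXse := square_integrableM X2 se2.
have cross : \int[P]_t ((X t * (s t * e t))%:E) = 0.
  under eq_integral do rewrite mulrA.
  apply: (@expectation_indepM0 _ _ _ _ (X \* s)%R e) => //.
  - exact: measurable_funM.
  - by apply: eq_integrable iXse => // t _; rewrite /= mulrA.
  - exact: square_integrable_integrable.
have E : \int[P]_t ((X t + s t * e t) ^+ 2)%:E <=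
    \int[P]_t (X t ^+ 2)%:E + v%:E * \int[P]_t (s t ^+ 2)%:E.
  under eq_integral => t _.
    rewrite (_ : ((X t + s t * e t) ^+ 2)%:E = (X t ^+ 2)%:E +
      (2%:E * (X t * (s t * e t))%:E + ((s t * e t) ^+ 2)%:E)); last first.
      by rewrite -EFinM -!EFinD; congr EFin; ring.
    over.
  rewrite integralD//; last 2 first.
  - exact: square_integrable_sqr.
  - apply: integrableD => //; last exact: square_integrable_sqr.
    exact: integrableZl.
  rewrite integralD//; last 2 first.
  - exact: integrableZl.
  - exact: square_integrable_sqr.
  by rewrite integralZl// cross mule0 add0e leeD2l.
split => //; split; first by apply: measurable_funD => //; exact: measurable_funM.
apply: le_lt_trans E _; apply: lte_add_pinfty => //.
by apply: lte_mul_pinfty; rewrite ?lee_fin//; have [] := s2.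
Qed.

End square_integrable.

Section summable.
Context (d : measure_display) (T : measurableType d) (R : realType)
  (P : probability T R).

(** The series of the [f k] has a finite integral, so it converges almost everywhere and its terms
    tend to zero. This plays the part of Borel-Cantelli. *)
Lemma ae_cvg0_summable (f : nat -> T -> R) (c : nat -> R) (M : R) :
  (forall k, measurable_fun setT (f k)) -> (forall k t, 0 <= f k t) ->
  (forall k, \int[P]_t (f k t)%:E <= (c k)%:E)%E ->
  (forall n, \sum_(k < n) c k <= M) ->
  {ae P, forall t, f k t @[k --> \oo] --> 0}.
Proof.
move=> mf f0 fc cM.
pose g t := (\sum_(0 <= k <oo) (f k t)%:E)%E.
have mfE k : measurable_fun setT (EFin \o f k) by exact/measurable_EFinP.
have ig : P.-integrable setT g.
  apply/integrableP; split.
    by apply: (@ge0_emeasurable_sum _ _ _ setT (fun k t => (f k t)%:E) xpredT)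
      => [k t _ _|k _]; [rewrite lee_fin|exact: mfE].
  under eq_integral => t _.
    rewrite gee0_abs; last by apply: nneseries_ge0 => k _ _; rewrite lee_fin.
    over.
  rewrite integral_nneseries//; last by move=> k t _; rewrite lee_fin.
  apply: (@le_lt_trans _ _ M%:E); last exact: ltry.
  apply: lime_le.
    by apply: is_cvg_nneseries => k _ _; apply: integral_ge0 => t _; rewrite lee_fin.
  apply: nearW => n; apply: (@le_trans _ _ (\sum_(0 <= k < n) (c k)%:E)%E).
    by apply: lee_sum => k _; exact: fc.
  by rewrite sumEFin lee_fin big_mkord.
apply: filterS (integrable_ae measurableT ig) => t /(_ Logic.I) gfin.
apply: cvg_series_cvg_0; apply: nondecreasing_is_cvgn.
  by apply: nondecreasing_series => k _ _; exact: f0.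
exists (fine (g t)) => _ [n _ <-]; rewrite -lee_fin fineK// /series/= -sumEFin.
by apply: nneseries_lim_ge => k _ _; rewrite lee_fin.
Qed.

End summable.

(** * Averages *)

Section cesaro.
Context (R : realType).
Implicit Types a b : nat -> R.

Definition average a (N : nat) : R := N%:R^-1 * \sum_(n < N) a n.

Lemma square_bracket N : (0 < N)%N -> exists k, (k.+1 ^ 2 <= N < k.+2 ^ 2)%N.
Proof.
elim: N => // -[_ _|N /(_ isT)[k /andP[kN Nk]] _]; first by exists 0%N.
have [Nk'|Nk'] := ltnP N.+2 (k.+2 ^ 2).
  by exists k; rewrite (leq_trans kN).
exists k.+1; rewrite Nk'/=; apply: leq_ltn_trans Nk _.
by rewrite ltn_exp2r.
Qed.

(** For [N] between consecutive squares, the partial sum differs from the one at the lower square by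
    at most the absolute block sum, and dividing by [N] instead of that square only decreases the
    result. *)
Lemma average_cvg0_squares a :
  (k.+1 ^ 2)%:R^-1 * \sum_(n < k.+1 ^ 2) a n @[k --> \oo] --> 0 ->
  (k.+1 ^ 2)%:R^-1 * \sum_(k.+1 ^ 2 <= n < k.+2 ^ 2) `|a n| @[k --> \oo] --> 0 ->
  average a N @[N --> \oo] --> 0.
Proof.
move=> /cvgrPdist_lt h1 /cvgrPdist_lt h2; apply/cvgrPdist_lt => e e0.
have e2 : 0 < e / 2 by rewrite divr_gt0.
have [k1 _ K1] := h1 _ e2; have [k2 _ K2] := h2 _ e2.
exists ((maxn k1 k2).+1 ^ 2)%N => // N /= kN.
have N0 : (0 < N)%N by apply: leq_trans kN; rewrite expn_gt0.
have [k /andP[kN1 kN2]] := square_bracket N0.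
have kk : (maxn k1 k2 <= k)%N.
  by have := leq_ltn_trans kN kN2; rewrite ltn_exp2r// !ltnS.
have {}K1 := K1 k (leq_trans (leq_maxl _ _) kk).
have {}K2 := K2 k (leq_trans (leq_maxr _ _) kk).
move: K1 K2; rewrite /= !sub0r !normrN => K1 K2.
rewrite (splitr e); apply: le_lt_trans (ltrD K1 K2).
have c0 : 0 < (k.+1 ^ 2)%:R :> R by rewrite ltr0n expn_gt0.
rewrite /average !normrM -mulrDr.
apply: (@le_trans _ _ (`|(k.+1 ^ 2)%:R^-1| * `|\sum_(n < N) a n|)).
  rewrite ler_wpM2r// !ger0_norm ?invr_ge0// lef_pV2 ?posrE ?ltr0n//.
  by rewrite ler_nat.
rewrite ler_wpM2l// -(big_mkord xpredT a) (big_cat_nat _ kN1)//= big_mkord.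
rewrite (le_trans (ler_normD _ _))// lerD2l (le_trans (ler_norm_sum _ _ _))//.
rewrite [leRHS]ger0_norm ?sumr_ge0//.
rewrite [leRHS](big_cat_nat kN1 (ltnW kN2))//= lerDl sumr_ge0//.
Qed.

Lemma sum_inv_sqr_le2 n : \sum_(k < n) (k.+1 ^ 2)%:R^-1 <= 2 :> R.
Proof.
case: n => [|n]; first by rewrite big_ord0.
(* The subtracted inverse makes the bound inductive: with [x = n + 1], each step has exact slack
   [1 / (x (x + 1)^2)]. *)
suff : \sum_(k < n.+1) (k.+1 ^ 2)%:R^-1 <= 2 - n.+1%:R^-1 :> R.
  by move=> /le_trans; apply; rewrite gerBl invr_ge0.
elim: n => [|n IH]; first by rewrite big_ord_recl big_ord0 /= addr0 !invr1; lra.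
rewrite big_ord_recr/=; apply: le_trans (lerD IH (lexx _)) _.
rewrite natrX -[n.+2]addn1 natrD.
have x0 : 0 < n.+1%:R :> R by rewrite ltr0n.
move: (n.+1%:R : R) x0 => x x0.
rewrite -subr_ge0.
have -> : 2 - (x + 1)^-1 - (2 - x^-1 + (x + 1) ^- 2) = (x * (x + 1) ^+ 2)^-1.
  by field; rewrite !gt_eqF// addr_gt0.
by rewrite invr_ge0 mulr_ge0 ?sqr_ge0// ltW.
Qed.

Lemma cauchy_schwarz_sum (I : Type) (r : seq I) (f g : I -> R) :
  (\sum_(i <- r) f i * g i) ^+ 2 <=
  (\sum_(i <- r) f i ^+ 2) * (\sum_(i <- r) g i ^+ 2).
Proof.
elim: r => [|i r IH]; first by rewrite !big_nil expr0n/= mulr0.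
rewrite !big_cons; set p := \sum_(j <- r) f j * g j in IH *.
set a := \sum_(j <- r) f j ^+ 2 in IH *; set b := \sum_(j <- r) g j ^+ 2 in IH *.
have a0 : 0 <= a by apply: sumr_ge0 => j _; exact: sqr_ge0.
have b0 : 0 <= b by apply: sumr_ge0 => j _; exact: sqr_ge0.
move: (f i) (g i) => x y.
(* Only the cross term is left; by induction [p] is at most the product of the roots of [a] and [b],
   and the arithmetic-geometric mean inequality concludes. *)
suff : 2 * (x * y) * p <= x ^+ 2 * b + a * y ^+ 2 by move=> ?; nra.
have [c0 d0] : 0 <= Num.sqrt a /\ 0 <= Num.sqrt b by rewrite !sqrtr_ge0.
have pab : `|p| <= Num.sqrt a * Num.sqrt b.
  by rewrite -sqrtrM// -sqrtr_sqr ler_wsqrtr.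
rewrite -(sqr_sqrtr a0) -(sqr_sqrtr b0).
apply: le_trans (ler_norm _) _; rewrite !normrM [`|2|]ger0_norm//.
rewrite -(real_normK (num_real x)) -(real_normK (num_real y)).
have := normr_ge0 x; have := normr_ge0 y; move: `|x| `|y| => X Y Y0 X0.
have := mulr_ge0 X0 Y0.
move: pab c0 d0 (normr_ge0 p); move: `|p| (Num.sqrt a) (Num.sqrt b) => p' c e.
move=> pab c0 d0 p0 XY.
apply: (@le_trans _ _ (2 * (X * Y) * (c * e))); last first.
  by have := sqr_ge0 (X * e - Y * c); nra.
by rewrite ler_wpM2l// mulr_ge0.
Qed.

Lemma sqr_sum_le (a : nat -> R) m n :
  (\sum_(m <= i < n) a i) ^+ 2 <= (n - m)%:R * \sum_(m <= i < n) a i ^+ 2.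
Proof.
have := @cauchy_schwarz_sum _ (index_iota m n) (fun=> 1) a.
under eq_bigr do rewrite mul1r.
by under [X in _ <= X * _ -> _]eq_bigr do rewrite expr1n; rewrite sumr_const_nat.
Qed.

Lemma cvg0_sqr a : a n ^+ 2 @[n --> \oo] --> 0 -> a n @[n --> \oo] --> 0.
Proof.
move=> /cvgrPdist_lt h; apply/cvgrPdist_lt => e e0.
have [N _ hN] := h _ (exprn_gt0 2 e0); exists N => // n /hN /=.
by rewrite !sub0r !normrN normrX ltr_pXn2r ?nnegrE// ltW.
Qed.

Lemma average_cvg_center a c :
  average (fun n => a n - c) N @[N --> \oo] --> 0 -> average a N @[N --> \oo] --> c.
Proof.
move=> /cvgrPdist_lt h; apply/cvgrPdist_lt => e /h[N0 _ hN]; exists N0.+1 => // N /= NN.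
have := hN N (ltnW NN); rewrite /= sub0r normrN distrC.
rewrite /average sumrB sumr_const card_ord mulrBr -[c *+ N]mulr_natr mulrCA.
by rewrite mulVf ?mulr1// pnatr_eq0 -lt0n (leq_ltn_trans _ NN).
Qed.

End cesaro.

(** * Laws of large numbers for martingale transforms *)

Section adapted.
Context (d : measure_display) (T : measurableType d) (R : realType).
Implicit Types (H : set (set T)) (X Y : T -> R).

(** [H] is a mere generating family, so filtrations can be given by their generators. *)
Definition adapted H X :=
  @measurable_fun _ _ (g_sigma_algebraType H) (measurableTypeR R) setT X.

Lemma adapted_preimage H X U : adapted H X -> measurable U -> <<s H >> (X @^-1` U).
Proof. by move=> aX mU; rewrite -[X in <<s _ >> X]setTI; exact: aX. Qed.

Lemma adaptedS H H' X : H `<=` <<s H' >> -> adapted H X -> adapted H' X.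
Proof.
move=> HH' aX _ U mU; have := aX measurableT U mU.
by apply: smallest_sub; first exact: smallest_sigma_algebra.
Qed.

Lemma adapted_measurable H X : H `<=` measurable -> adapted H X ->
  measurable_fun setT X.
Proof.
move=> Hm aX _ U mU; have := aX measurableT U mU.
by apply: smallest_sub => //; exact: sigma_algebra_measurable.
Qed.

Lemma adapted_cst H r : adapted H (cst r). Proof. exact: measurable_cst. Qed.

Lemma adaptedM H X Y : adapted H X -> adapted H Y -> adapted H (X \* Y).
Proof. exact: measurable_funM. Qed.

Lemma adaptedD H X Y : adapted H X -> adapted H Y -> adapted H (X \+ Y).
Proof. exact: measurable_funD. Qed.

Lemma adapted_sum H (I : Type) (s : seq I) (X : I -> T -> R) :
  (forall i, adapted H (X i)) -> adapted H (fun t => \sum_(i <- s) X i t).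
Proof. exact: measurable_sum. Qed.

End adapted.

Section martingale.
Context (d : measure_display) (T : measurableType d) (R : realType)
  (P : probability T R).
Variables (H : nat -> set (set T)) (e : nat -> T -> R) (v : R).
Hypotheses (Hm : forall n, H n `<=` measurable)
  (Hmono : forall n, H n `<=` <<s H n.+1 >>)
  (He : forall n, adapted (H n.+1) (e n))
  (Hind : forall n A U, <<s H n >> A -> measurable U ->
    P (A `&` e n @^-1` U) = (P A * P (e n @^-1` U))%E)
  (e0 : forall n, (\int[P]_t (e n t)%:E = 0)%E)
  (ev : forall n, (\int[P]_t (e n t ^+ 2)%:E <= v%:E)%E).

Let He_m n : measurable_fun setT (e n).
Proof. exact: (adapted_measurable (@Hm n.+1) (@He n)). Qed.

Let He_sq n : square_integrable P (e n).
Proof. by split => //; apply: le_lt_trans (ev n) _; rewrite ltry. Qed.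

Let ind n (X : T -> R) : adapted (H n) X -> independent_rv P X (e n).
Proof. by move=> aX U V mU mV; apply: Hind => //; exact: adapted_preimage. Qed.

Let v0 : 0 <= v.
Proof.
by rewrite -lee_fin (le_trans _ (ev 0%N))//; apply: integral_ge0 => t _;
  rewrite lee_fin sqr_ge0.
Qed.

Lemma adapted_le m n (X : T -> R) : (m <= n)%N -> adapted (H m) X -> adapted (H n) X.
Proof.
move=> /subnKC <-; elim: (n - m)%N => [|k IH] aX; first by rewrite addn0.
by rewrite addnS; apply: adaptedS (IH aX); exact: Hmono.
Qed.

Section transform.
Variables (s : nat -> T -> R) (c : nat -> R) (K : R).
Hypotheses (Hs : forall n, adapted (H n) (s n))
  (sc : forall n t, `|s n t| <= c n)
  (sK : forall N t, \sum_(n < N) s n t ^+ 2 <= K * N%:R).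

Let X N t := \sum_(n < N) s n t * e n t.

Let HX N : adapted (H N) (X N).
Proof.
apply: adapted_sum => i; apply: adaptedM.
  exact: adapted_le (ltnW (ltn_ord i)) (@Hs i).
exact: adapted_le (ltn_ord i) (@He i).
Qed.

Let Hs_m n : measurable_fun setT (s n).
Proof. exact: adapted_measurable (@Hm n) (@Hs n). Qed.

Let X_bound N : square_integrable P (X N) /\
  (\int[P]_t (X N t ^+ 2)%:E <=
   v%:E * \int[P]_t (\sum_(n < N) s n t ^+ 2)%:E)%E.
Proof.
elim: N => [|N [IH1 IH2]].
  have X0 : X 0 = cst 0 by apply/funext => t; rewrite /X big_ord0.
  split.
    by rewrite X0; apply: (@square_integrable_bounded _ _ _ _ _ 0) => // t; rewrite normr0.
  rewrite X0; under eq_integral do rewrite expr0n/=.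
  rewrite integral0; apply: mule_ge0; first by rewrite lee_fin.
  by apply: integral_ge0 => t _; rewrite lee_fin big_ord0.
have XS : X N.+1 = (X N \+ s N \* e N).
  by apply/funext => t; rewrite /X big_ord_recr.
rewrite XS.
have [] := @expectation_sqr_increment _ _ _ P (X N) (s N) (e N) (c N) v IH1
  (@Hs_m N) (sc N) (He_sq N) (ind (adaptedM (@HX N) (@Hs N))) (ind (@Hs N)) (e0 N) (ev N).
move=> S1 S2; split => //; apply: le_trans S2 _.
under [in leRHS]eq_integral do rewrite big_ord_recr/= EFinD.
rewrite ge0_integralD//; last 4 first.
- by move=> t _; rewrite lee_fin sumr_ge0// => i _; rewrite sqr_ge0.
- by apply/measurable_EFinP/measurable_sum => i; exact: measurable_funX.
- by move=> t _; rewrite lee_fin sqr_ge0.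
- by apply/measurable_EFinP/measurable_funX.
rewrite [leRHS]ge0_muleDr; last 2 first.
- by apply: integral_ge0 => t _; rewrite lee_fin sumr_ge0// => i _; rewrite sqr_ge0.
- by apply: integral_ge0 => t _; rewrite lee_fin sqr_ge0.
by rewrite leeD2r.
Qed.

Lemma martingale_sqr_le N : (\int[P]_t (X N t ^+ 2)%:E <= (v * (K * N%:R))%:E)%E.
Proof.
have [_ /le_trans] := X_bound N; apply; rewrite EFinM lee_wpmul2l ?lee_fin//.
apply: (@le_trans _ _ (\int[P]_t (K * N%:R)%:E)%E).
  apply: ge0_le_integral => //.
  - by move=> t _; rewrite lee_fin sumr_ge0// => i _; rewrite sqr_ge0.
  - by apply/measurable_EFinP/measurable_sum => i; exact: measurable_funX.
  - by move=> t _; rewrite lee_fin.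
by rewrite integral_cst//= probability_setT mule1.
Qed.

(** At [N = (k + 1) ^ 2] the mean square of the normalized sum is at most [v K / N], which is
    summable in [k]. The pointwise bounds [c n] may grow: the rate depends on [K] alone. *)
Lemma martingale_squares : {ae P, forall t,
  (k.+1 ^ 2)%:R^-1 * X (k.+1 ^ 2) t @[k --> \oo] --> 0}.
Proof.
have HXm N : measurable_fun setT (X N) := adapted_measurable (@Hm N) (@HX N).
have K0 : 0 <= K.
  have := sK 1 point; rewrite big_ord_recl big_ord0 addr0 mulr1.
  by apply: le_trans; rewrite sqr_ge0.
have := @ae_cvg0_summable _ _ _ P
  (fun k t => ((k.+1 ^ 2)%:R^-1 * X (k.+1 ^ 2) t) ^+ 2)
  (fun k => v * K * (k.+1 ^ 2)%:R^-1) (v * K * 2) _ _ _ _.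
move=> H0; apply: filterS (H0 _ _ _ _).
- by move=> t; exact: cvg0_sqr.
- by move=> k; apply: measurable_funX; exact: measurable_funM.
- by move=> k t; rewrite sqr_ge0.
- move=> k; set m : R := (k.+1 ^ 2)%:R.
  have m0 : 0 < m by rewrite ltr0n expn_gt0.
  under eq_integral do rewrite exprMn EFinM.
  rewrite ge0_integralZl_EFin//; last 3 first.
  + by move=> t _; rewrite lee_fin sqr_ge0.
  + by apply/measurable_EFinP/measurable_funX.
  + by rewrite sqr_ge0.
  apply: (le_trans (lee_wpmul2l _ (martingale_sqr_le _))).
    by rewrite lee_fin sqr_ge0.
  rewrite -/m -EFinM lee_fin (_ : m^-1 ^+ 2 * _ = v * K * m^-1)//.
  by field; rewrite gt_eqF.
- by move=> n; rewrite -mulr_sumr ler_wpM2l ?mulr_ge0// sum_inv_sqr_le2.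
Qed.

End transform.

(** Cauchy-Schwarz over a block of [2 (k + 1) + 1 <= 3 (k + 1)] indices; 9 is the square of this 3.
    No cancellation between the terms is used. *)
Let block_bound k : (\int[P]_t (((k.+1 ^ 2)%:R^-1 *
    \sum_(k.+1 ^ 2 <= n < k.+2 ^ 2) `|e n t|) ^+ 2)%:E <=
  (9 * v * (k.+1 ^ 2)%:R^-1)%:E)%E.
Proof.
set m : R := (k.+1 ^ 2)%:R; pose B := (k.+2 ^ 2 - k.+1 ^ 2)%N.
have m0 : 0 < m by rewrite ltr0n expn_gt0.
have BE : B%:R = 2 * k.+1%:R + 1 :> R.
  rewrite natrB ?leq_exp2r// !natrX -[k.+2]addn1 natrD; ring.
have B9 : B%:R ^+ 2 <= 9 * m.
  rewrite BE /m natrX; have : 1 <= k.+1%:R :> R by rewrite ler1n.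
  by move: (k.+1%:R : R) => x x1; nra.
have CS t : (m^-1 * \sum_(k.+1 ^ 2 <= n < k.+2 ^ 2) `|e n t|) ^+ 2 <=
    m^-1 ^+ 2 * B%:R * \sum_(k.+1 ^ 2 <= n < k.+2 ^ 2) e n t ^+ 2.
  rewrite exprMn -mulrA ler_wpM2l ?sqr_ge0//.
  apply: (le_trans (sqr_sum_le _ _ _)).
  by rewrite -/B; under [X in _ * X <= _]eq_bigr do rewrite real_normK ?num_real//.
apply: (@le_trans _ _ (\int[P]_t
    ((m^-1 ^+ 2 * B%:R)%:E * (\sum_(k.+1 ^ 2 <= n < k.+2 ^ 2) e n t ^+ 2)%:E))%E).
  apply: ge0_le_integral => //.
  - by move=> t _; rewrite lee_fin sqr_ge0.
  - apply/measurable_EFinP/measurable_funX/measurable_funM => //.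
    by apply: measurable_sum => n; exact: measurableT_comp.
  - apply/measurable_EFinP/measurable_funM => //.
    by apply: measurable_sum => n; exact: measurable_funX.
  - by move=> t _; rewrite -EFinM lee_fin.
rewrite ge0_integralZl_EFin//; last 3 first.
- by move=> t _; rewrite lee_fin sumr_ge0// => n _; rewrite sqr_ge0.
- by apply/measurable_EFinP/measurable_sum => n; exact: measurable_funX.
- by rewrite mulr_ge0 ?sqr_ge0.
apply: (@le_trans _ _ ((m^-1 ^+ 2 * B%:R)%:E * (v * B%:R)%:E)%E).
  apply: lee_wpmul2l; first by rewrite lee_fin mulr_ge0 ?sqr_ge0.
  under eq_integral do rewrite -sumEFin.
  rewrite ge0_integral_sum//; last 2 first.
  - by move=> n; apply/measurable_EFinP/measurable_funX.
  - by move=> n t _; rewrite lee_fin sqr_ge0.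
  apply: (le_trans (lee_sum _ (fun n _ => ev n))).
  by rewrite sumEFin big_const_nat iter_addr_0 -/B mulr_natr.
rewrite -EFinM lee_fin (_ : 9 * v * m^-1 = m^-1 ^+ 2 * v * (9 * m)); last first.
  by field; rewrite gt_eqF.
rewrite (_ : m^-1 ^+ 2 * B%:R * (v * B%:R) = m^-1 ^+ 2 * v * B%:R ^+ 2); last by ring.
by rewrite ler_wpM2l// mulr_ge0 ?sqr_ge0.
Qed.

Lemma martingale_average : {ae P, forall t, average (e ^~ t) N @[N --> \oo] --> 0}.
Proof.
have sq := @martingale_squares (fun _ _ => 1) (fun=> 1) 1 _ _ _.
have {}sq := sq (fun=> @adapted_cst _ _ _ _ 1) _ _.
have bl := @ae_cvg0_summable _ _ _ P
  (fun k t => ((k.+1 ^ 2)%:R^-1 * \sum_(k.+1 ^ 2 <= n < k.+2 ^ 2) `|e n t|) ^+ 2)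
  (fun k => 9 * v * (k.+1 ^ 2)%:R^-1) (9 * v * 2) _ _ block_bound _.
apply: filterS2 (sq _ _) (bl _ _ _).
- move=> t h1 h2; apply: average_cvg0_squares; last exact: cvg0_sqr.
  by under eq_cvg do under eq_bigr do rewrite -[e _ _]mul1r.
- by move=> n t; rewrite normr1.
- by move=> N t; rewrite expr1n sumr_const card_ord mul1r.
- move=> k; apply: measurable_funX; apply: measurable_funM => //.
  by apply: measurable_sum => n; exact: measurableT_comp.
- by move=> k t; rewrite sqr_ge0.
- by move=> n; rewrite -mulr_sumr ler_wpM2l ?mulr_ge0// sum_inv_sqr_le2.
Qed.

(** * Predictable multipliers whose power bound depends on the path *)

Section predictable.
Variable s : nat -> T -> R.
Hypothesis Hs : forall n, adapted (H n) (s n).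
Hypothesis e2 : {ae P, forall t,
  exists l : R, average (fun n => e n t ^+ 2) N @[N --> \oo] --> l}.

Let S n t := \sum_(j < n.+1) s j t ^+ 2.

(* Setting [s] to 0 whenever its running energy exceeds the bound keeps it
   adapted and makes the bound hold surely; it changes nothing where the bound holds. *)
Let trunc (K : nat) n t := if S n t <= (K * n.+1)%:R then s n t else 0.

Let Htrunc K n : adapted (H n) (trunc K n).
Proof.
have HS : adapted (H n) (S n).
  apply: adapted_sum => j; apply: measurable_funX.
  by apply: adapted_le (@Hs j); rewrite -ltnS.
apply: measurable_fun_ifT; [|exact: Hs|exact: measurable_cst].
exact: measurable_fun_ler.
Qed.

Let trunc_sum K N t : \sum_(n < N) trunc K n t ^+ 2 <= K%:R * N%:R.
Proof.
elim: N => [|N IH]; first by rewrite big_ord0 mulr0.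
rewrite big_ord_recr/= {2}/trunc; case: ifPn => [SK|_].
  rewrite -natrM; apply: le_trans SK; rewrite /S big_ord_recr/= lerD2r.
  apply: ler_sum => i _; rewrite /trunc; case: ifP => // _.
  by rewrite expr0n/= sqr_ge0.
by rewrite expr0n/= addr0 (le_trans IH)// ler_wpM2l// ler_nat.
Qed.

(** Cauchy-Schwarz on one path. The energy of [s] up to the end of the block is at most
    [K (k + 2)^2 <= 4 K (k + 1)^2]. The energy of [e] in the block is [o(k ^ 2)], since the averages
    of [e ^ 2] converge and the ratio of consecutive squares tends to 1. *)
Let block_cvg t (K l : R) :
  (forall N, \sum_(n < N) s n t ^+ 2 <= K * N%:R) ->
  average (fun n => e n t ^+ 2) N @[N --> \oo] --> l ->
  (k.+1 ^ 2)%:R^-1 * \sum_(k.+1 ^ 2 <= n < k.+2 ^ 2) `|s n t * e n t|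
     @[k --> \oo] --> 0.
Proof.
move=> sK el.
have K0 : 0 <= K.
  have := sK 1; rewrite big_ord_recl big_ord0 addr0 mulr1.
  by apply: le_trans; rewrite sqr_ge0.
pose E N := \sum_(n < N) e n t ^+ 2.
pose b k := (k.+2 ^ 2)%:R / (k.+1 ^ 2)%:R : R.
have sub1 : (k.+1 ^ 2)%N @[k --> \oo] --> \oo.
  apply/cvgnyPge => A; exists A => // k /= Ak; apply: leq_trans Ak _.
  by rewrite expnS expn1; nia.
have sub2 : (k.+2 ^ 2)%N @[k --> \oo] --> \oo.
  apply/cvgnyPge => A; exists A => // k /= Ak; apply: leq_trans Ak _.
  by rewrite expnS expn1; nia.
have bl : b k @[k --> \oo] --> (1 : R).
  have -> : b = (fun k => (1 + k.+1%:R^-1) * (1 + k.+1%:R^-1)).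
    apply/funext => k; rewrite /b !natrX -[k.+2]addn1 natrD.
    have : k.+1%:R != 0 :> R by rewrite pnatr_eq0.
    by move: (k.+1%:R : R) => x x0; field.
  have h : 1 + k.+1%:R^-1 @[k --> \oo] --> (1 : R).
    rewrite -[X in _ --> X]addr0; apply: cvgD; [exact: cvg_cst|exact: cvg_harmonic].
  by rewrite -[X in _ --> X]mul1r; exact: cvgM.
have Ebl : b k * average (fun n => e n t ^+ 2) (k.+2 ^ 2) -
           average (fun n => e n t ^+ 2) (k.+1 ^ 2) @[k --> \oo] --> (0 : R).
  rewrite -[X in _ --> X](subrr l) -{1}[l]mul1r.
  by apply: cvgB; [apply: cvgM => //|]; apply: cvg_comp el.
have EbE k : b k * average (fun n => e n t ^+ 2) (k.+2 ^ 2) -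
           average (fun n => e n t ^+ 2) (k.+1 ^ 2) =
  (k.+1 ^ 2)%:R^-1 * \sum_(k.+1 ^ 2 <= n < k.+2 ^ 2) e n t ^+ 2.
  have c1 : (k.+1 ^ 2)%:R != 0 :> R by rewrite pnatr_eq0 expn_eq0.
  have c2 : (k.+2 ^ 2)%:R != 0 :> R by rewrite pnatr_eq0 expn_eq0.
  rewrite /average /b -!(big_mkord xpredT (fun n => e n t ^+ 2)).
  rewrite (@big_cat_nat _ _ _ (k.+1 ^ 2) 0 (k.+2 ^ 2)) ?leq_exp2r//=.
  by move: (k.+1 ^ 2)%:R (k.+2 ^ 2)%:R c1 c2 => x y x0 y0; field; rewrite x0 y0.
have {}Ebl : 4 * K * ((k.+1 ^ 2)%:R^-1 * \sum_(k.+1 ^ 2 <= n < k.+2 ^ 2) e n t ^+ 2)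
   @[k --> \oo] --> 0.
  rewrite -[X in _ --> X](mulr0 (4 * K)); apply: cvgM; first exact: cvg_cst.
  by under eq_cvg do rewrite -EbE.
apply: cvg0_sqr; apply: (squeeze_cvgr _ (cvg_cst 0) Ebl).
apply: nearW => k; rewrite sqr_ge0/=.
set m : R := (k.+1 ^ 2)%:R.
have m0 : 0 < m by rewrite ltr0n expn_gt0.
rewrite exprMn.
under eq_bigr do rewrite normrM.
apply: (le_trans (ler_wpM2l (sqr_ge0 _) (cauchy_schwarz_sum
  (index_iota (k.+1 ^ 2) (k.+2 ^ 2)) (fun n => `|s n t|) (fun n => `|e n t|)))).
have normE (f : nat -> R) : \sum_(k.+1 ^ 2 <= n < k.+2 ^ 2) `|f n| ^+ 2 =
    \sum_(k.+1 ^ 2 <= n < k.+2 ^ 2) f n ^+ 2.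
  by apply: eq_bigr => n _; rewrite real_normK ?num_real.
rewrite !normE.
rewrite (_ : 4 * K * (m^-1 * _) = m^-1 ^+ 2 * ((4 * K * m) *
    \sum_(k.+1 ^ 2 <= n < k.+2 ^ 2) e n t ^+ 2)); last first.
  by field; rewrite gt_eqF.
rewrite ler_wpM2l ?sqr_ge0// ler_wpM2r ?sumr_ge0// => [n _|]; first exact: sqr_ge0.
apply: (@le_trans _ _ (K * (k.+2 ^ 2)%:R)).
  apply: le_trans (sK _); rewrite -(big_mkord xpredT (fun n => s n t ^+ 2)).
  rewrite [leRHS](@big_cat_nat _ _ _ (k.+1 ^ 2))//= ?leq_exp2r// lerDr sumr_ge0// => n _.
  exact: sqr_ge0.
rewrite -mulrA mulrCA ler_wpM2l// /m -natrM ler_nat !expnS !expn0; nia.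
Qed.

(** The bound [K] varies with the path, so the truncated law is applied at every natural level at
    once, a countable number of events. On a given path any level above [K] leaves [s] untouched.
    The sure bound on a truncated multiplier is the root of its total energy bound. *)
Lemma martingale_transform_average : {ae P, forall t,
  (exists K : R, forall N, \sum_(n < N) s n t ^+ 2 <= K * N%:R) ->
  average (fun n => s n t * e n t) N @[N --> \oo] --> 0}.
Proof.
have sq (K : nat) := @martingale_squares (trunc K)
  (fun n => Num.sqrt (K%:R * n.+1%:R)) K%:R (@Htrunc K) _ (trunc_sum K).
have {}sq : {ae P, forall t K, (k.+1 ^ 2)%:R^-1 * \sum_(n < k.+1 ^ 2) trunc K n t * e n t
   @[k --> \oo] --> 0}.
  apply: ae_foralln => K; apply: sq => {}K n t.
  rewrite -sqrtr_sqr ler_wsqrtr// (le_trans _ (trunc_sum K n.+1 t))//.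
  by rewrite big_ord_recr/= lerDr sumr_ge0// => i _; rewrite sqr_ge0.
apply: filterS2 sq e2 => t sq [l el] [K sK].
apply: average_cvg0_squares; last exact: block_cvg sK el.
have K0 : 0 <= K.
  have := sK 1; rewrite big_ord_recl big_ord0 addr0 mulr1.
  by apply: le_trans; rewrite sqr_ge0.
have [K' KK'] : exists K' : nat, K <= K'%:R.
  by exists (Num.truncn K).+1; rewrite ltW// truncnS_gt.
suff sE n : trunc K' n t = s n t.
  by have := sq K'; under [X in X @ _ --> _]eq_fun do under eq_bigr do rewrite sE.
rewrite /trunc ifT// /S (le_trans (sK _))// natrM ler_wpM2r//.
Qed.

End predictable.

End martingale.

(** * Gaussian moments *)

Section density.
Context (d : measure_display) (T : measurableType d) (R : realType)
  (mu nu : {measure set T -> \bar R}) (h : T -> R).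
Hypotheses (mh : measurable_fun setT h) (h0 : forall x, 0 <= h x)
  (nuE : forall A, measurable A -> (nu A = \int[mu]_(x in A) (h x)%:E)%E).
Local Open Scope ereal_scope.
Import HBNNSimple.

Let mhE : measurable_fun setT (EFin \o h). Proof. exact/measurable_EFinP. Qed.

Let integral_density_indic E : measurable E ->
  \int[nu]_x (\1_E x)%:E = \int[mu]_x ((\1_E x)%:E * (h x)%:E).
Proof.
move=> mE; rewrite integral_indic// setIT nuE// integral_mkcond.
apply: eq_integral => x _; rewrite patchE indicE.
by case: ifP => _; rewrite ?mul1e ?mul0e.
Qed.

Let integral_density_nnsfun (f : {nnsfun T >-> R}) :
  \int[nu]_x (f x)%:E = \int[mu]_x ((f x)%:E * (h x)%:E).
Proof.
under [LHS]eq_integral do rewrite fimfunE -fsumEFin//.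
rewrite [LHS]ge0_integral_fsum//; last 2 first.
  - by move=> r; exact/measurable_EFinP/measurableT_comp.
  - by move=> n x _; rewrite EFinM nnfun_muleindic_ge0.
under [RHS]eq_integral.
  move=> x xD; rewrite fimfunE -fsumEFin// muleC ge0_mule_fsumr; last first.
    by move=> r; rewrite EFinM nnfun_muleindic_ge0.
  over.
rewrite [RHS]ge0_integral_fsum//; last 2 first.
  - move=> r; apply: emeasurable_funM => //.
    by apply/measurable_EFinP; apply/measurableT_comp => //.
  - move=> n x _; apply: mule_ge0; first by rewrite lee_fin.
    by rewrite EFinM nnfun_muleindic_ge0.
apply: eq_fsbigr => r _.
under [RHS]eq_integral do rewrite EFinM muleCA.
rewrite integralZl_indic_nnsfun//= integral_density_indic//.
have [r0|r0] := leP 0%R r.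
  rewrite ge0_integralZl//; last 2 first.
  - by apply: emeasurable_funM => //; exact/measurable_EFinP/measurable_indic.
  - by move=> x _; rewrite mule_ge0// lee_fin.
  by congr (_ * _); apply: eq_integral => x _; rewrite muleC.
rewrite preimage_nnfun0// indic0.
by rewrite !integral0_eq ?mule0// => x _; rewrite ?mule0 ?mul0e ?mule0//.
Qed.

(** Passes from indicators to simple functions, then to monotone limits. *)
Lemma ge0_integral_density (f : T -> \bar R) :
  measurable_fun setT f -> (forall x, 0 <= f x) ->
  \int[nu]_x f x = \int[mu]_x (f x * (h x)%:E).
Proof.
move=> mf f0; pose f_ := nnsfun_approx measurableT mf.
transitivity (lim (\int[nu]_x (f_ n x)%:E @[n --> \oo])).
  rewrite -monotone_convergence//=.
  - by apply: eq_integral => ? /[!inE] xD; apply/esym/cvg_lim => //=;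
      exact: cvg_nnsfun_approx.
  - by move=> n; exact/measurable_EFinP/measurable_funTS.
  - by move=> n ? _; rewrite lee_fin.
  - by move=> ? _ ? ? mn; rewrite lee_fin; exact/lefP/nd_nnsfun_approx.
transitivity (lim (\int[mu]_x ((f_ n x)%:E * (h x)%:E) @[n --> \oo])).
  by apply: congr_lim; apply/funext => n /=; exact: integral_density_nnsfun.
rewrite -monotone_convergence//=.
- apply: eq_integral => x _; apply/cvg_lim => //=.
  apply: cvgeZr => //; exact: cvg_nnsfun_approx.
- move=> n; apply: emeasurable_funM => //.
  exact/measurable_EFinP/measurable_funTS.
- by move=> n x _; rewrite mule_ge0// lee_fin.
- move=> x _ a b ab; rewrite lee_wpmul2r ?lee_fin//.
  exact/lefP/nd_nnsfun_approx.
Qed.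

End density.

Section normal_moments.
Context (R : realType).
Notation mu := (@lebesgue_measure R).

(* Bounding the integrand of the fourth moment by a normal density of twice the
   width avoids computing any Gaussian integral. *)
Lemma expRN_pow4_le (x : R) : x ^+ 4 * expR (- x ^+ 2 / 2) <= 32 * expR (- x ^+ 2 / 8).
Proof.
(* It remains to bound [x ^ 4] by [32 E ^ 2] with [E = exp (3 x ^ 2 / 16) >= 1 + 3 x ^ 2 / 16]; the
   square contains [9 x ^ 4 / 256], more than [x ^ 4 / 32]. *)
have -> : - x ^+ 2 / 2 = - x ^+ 2 / 8 + - (3 * x ^+ 2 / 8) by field.
rewrite expRD mulrCA [leRHS]mulrC ler_wpM2l ?expR_ge0// expRN.
have y0 : 0 <= 3 * x ^+ 2 / 8 / 2 by have := sqr_ge0 x; lra.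
rewrite ler_pdivrMr ?expR_gt0//.
have -> : 3 * x ^+ 2 / 8 = 3 * x ^+ 2 / 8 / 2 + 3 * x ^+ 2 / 8 / 2 by field.
rewrite expRD; have := expR_ge1Dx (3 * x ^+ 2 / 8 / 2).
move: (expR _) => E xE.
have -> : x ^+ 4 = x ^+ 2 * x ^+ 2 by ring.
move: (x ^+ 2) (sqr_ge0 x) xE y0 => y y0 yE _.
have : (1 + 3 * y / 8 / 2) * (1 + 3 * y / 8 / 2) <= E * E.
  by apply: ler_pM => //; lra.
by move=> ?; nra.
Qed.

(** Rescaling of the previous bound by [(x - m) / s]. Doubling the width halves the peak, so 64 is
    twice 32. *)
Lemma normal_pdf_pow4_le (m s x : R) : 0 < s ->
  (x - m) ^+ 4 * normal_pdf m s x <= 64 * s ^+ 4 * normal_pdf m (2 * s) x.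
Proof.
move=> s0; have s0' : s != 0 by rewrite gt_eqF.
have s2 : 2 * s != 0 by rewrite mulf_neq0.
rewrite !normal_pdfE// /normal_fun.
have pk : normal_peak s = 2 * normal_peak (2 * s).
  rewrite /normal_peak (_ : (2 * s) ^+ 2 * pi *+ 2 = 2 ^+ 2 * (s ^+ 2 * pi *+ 2)); last first.
    by rewrite !mulr2n; ring.
  by rewrite sqrtrM ?sqr_ge0// sqrtr_sqr ger0_norm// invfM mulrA divff ?mul1r.
rewrite pk; have := expRN_pow4_le ((x - m) / s).
rewrite (_ : - ((x - m) / s) ^+ 2 / 2 = - (x - m) ^+ 2 / (s ^+ 2 *+ 2)); last first.
  by rewrite -[_ *+ 2]mulr_natl; field.
rewrite (_ : - ((x - m) / s) ^+ 2 / 8 = - (x - m) ^+ 2 / ((2 * s) ^+ 2 *+ 2)); last first.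
  by rewrite -[_ *+ 2]mulr_natl; field.
move: (expR _) (expR _) (normal_peak (2 * s)) (normal_peak_ge0 (2 * s)) => E' E p p0.
rewrite exprMn exprVn mulrAC ler_pdivrMr ?exprn_gt0// => EE'.
rewrite (_ : (x - m) ^+ 4 * _ = 2 * p * ((x - m) ^+ 4 * E)); last by ring.
rewrite (_ : 64 * s ^+ 4 * _ = 2 * p * (32 * E' * s ^+ 4)); last by ring.
by rewrite ler_wpM2l// mulr_ge0.
Qed.

(** The product is the inverse root of [2 pi], and [2 pi >= 4]. *)
Lemma normal_peak_le (s : R) : 0 < s -> normal_peak s * s <= 2^-1.
Proof.
move=> s0; rewrite /normal_peak.
have pi2 : 2 <= pi :> R by exact: pi_ge2.
rewrite (_ : s ^+ 2 * pi *+ 2 = s ^+ 2 * (pi * 2)); last by rewrite mulr2n; ring.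
rewrite sqrtrM ?sqr_ge0// sqrtr_sqr gtr0_norm// invfM mulrAC mulVf ?gt_eqF// mul1r.
rewrite lef_pV2 ?posrE// ?sqrtr_gt0 ?mulr_gt0 ?pi_gt0//.
rewrite -[leLHS](ger0_norm (ler0n _ 2)) -sqrtr_sqr ler_wsqrtr//; nra.
Qed.

(* The parameters are controlled by the second moment: the density is at most
   [1 / (2 s)], whence [s ^+ 2 <= 8 v], and then
   [m ^+ 2 <= 2 v + 65 s ^+ 2 <= 23 ^+ 2 v]. *)
Lemma normal_law_moment4 (d : measure_display) (T : measurableType d)
    (P : probability T R) (X : T -> R) (m s v : R) :
  measurable_fun setT X -> 0 <= s ->
  (forall U, measurable U -> P (X @^-1` U) = normal_law m s U) ->
  (\int[P]_t (X t ^+ 2)%:E = v%:E)%E ->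
  (\int[P]_t (X t ^+ 4)%:E <= ((8 * (64 * 8 ^+ 2) + 8 * (23 ^+ 2) ^+ 2) * v ^+ 2)%:E)%E.
Proof.
move=> mX s0 XE X2.
pose X' : {mfun T >-> measurableTypeR R} := @mfun_Sub _ _ T (measurableTypeR R) X (mem_set mX).
have law (f : R -> \bar R) : measurable_fun setT f -> (forall x, 0 <= f x)%E ->
    (\int[P]_t f (X t) = \int[distribution P X']_x f x)%E.
  by move=> mf f0; rewrite ge0_integral_distribution.
have v0 : 0 <= v.
  by rewrite -lee_fin -X2; apply: integral_ge0 => t _; rewrite lee_fin sqr_ge0.
have mpow n : measurable_fun setT (fun x : R => (x ^+ n)%:E).
  by apply/measurable_EFinP; exact: measurable_funX.
(* For deviation 0 the law is the point mass at [m], so [v = m ^ 2] and the fourth moment is exactly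
   [v ^ 2]. *)
move: s0; rewrite le_eqVlt => /orP[/eqP s0|s0].
  have dE (f : R -> \bar R) : measurable_fun setT f -> (forall x, 0 <= f x)%E ->
      (\int[P]_t f (X t) = f m)%E.
    move=> mf f0; rewrite law//.
    transitivity (\int[dirac (m : measurableTypeR R)]_x f x)%E.
      apply: eq_measure_integral => A mA _.
      by rewrite -[LHS]/(P (X @^-1` A)) XE// /normal_law -s0 eqxx.
    by rewrite integral_dirac// diracE in_setT mul1e.
  move: X2; rewrite (dE (fun x => (x ^+ 2)%:E))//; last first.
    by move=> x; rewrite lee_fin sqr_ge0.
  move=> [<-]; rewrite (dE (fun x => (x ^+ 4)%:E))//; last first.
    by move=> x; rewrite lee_fin exprn_even_ge0.
  rewrite lee_fin -(exprM m 2 2) ler_peMl ?exprn_even_ge0//.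
  by lra.
have sn0 : s != 0 by rewrite gt_eqF.
have XE' A : measurable A -> P (X @^-1` A) = (\int[mu]_(x in A) (normal_pdf m s x)%:E)%E.
  by move=> mA; rewrite XE// /normal_law (negbTE sn0).
have nE (f : R -> \bar R) : measurable_fun setT f -> (forall x, 0 <= f x)%E ->
    (\int[P]_t f (X t) = \int[mu]_x (f x * (normal_pdf m s x)%:E))%E.
  move=> mf f0; rewrite law//; apply: ge0_integral_density => //.
  - exact: measurable_normal_pdf.
  - exact: normal_pdf_ge0.
have Xm4 : (\int[P]_t ((X t - m) ^+ 4)%:E <= (64 * s ^+ 4)%:E)%E.
  rewrite (nE (fun x => ((x - m) ^+ 4)%:E)); last 2 first.
  - by apply/measurable_EFinP/measurable_funX/measurable_funB.
  - by move=> x; rewrite lee_fin exprn_even_ge0.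
  apply: (@le_trans _ _ (\int[mu]_x ((64 * s ^+ 4)%:E * (normal_pdf m (2 * s) x)%:E))%E).
    apply: ge0_le_integral => //.
    - by move=> x _; rewrite mule_ge0 ?lee_fin ?exprn_even_ge0 ?normal_pdf_ge0.
    - apply: emeasurable_funM.
        by apply/measurable_EFinP/measurable_funX/measurable_funB.
      by apply/measurable_EFinP; exact: measurable_normal_pdf.
    - apply: emeasurable_funM => //.
      by apply/measurable_EFinP; exact: measurable_normal_pdf.
    - by move=> x _; rewrite -!EFinM lee_fin normal_pdf_pow4_le.
  rewrite ge0_integralZl_EFin//; last 3 first.
  - by move=> x _; rewrite lee_fin normal_pdf_ge0.
  - by apply/measurable_EFinP; exact: measurable_normal_pdf.
  - by rewrite mulr_ge0// exprn_ge0// ltW.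
  by rewrite integral_normal_pdf mule1.
(* An interval of length [s] around 0 has probability at most 1/2. Outside it [X ^ 2 >= s ^ 2 / 4],
   whence [v >= s ^ 2 / 8]. *)
have s8 : s ^+ 2 <= 8 * v.
  pose i : interval R := `]- (s / 2), (s / 2)[.
  pose I : set R := [set` i].
  have muI : mu I = s%:E.
    rewrite lebesgue_measure_itv/= lte_fin ifT; last by lra.
    by rewrite -EFinD (_ : s / 2 - - (s / 2) = s)//; field.
  have mI : measurable I by exact: measurable_itv.
  have PI : (P (X @^-1` I) <= (2^-1)%:E)%E.
    rewrite (XE' _ mI); apply: (@le_trans _ _ (\int[mu]_(x in I) (normal_peak s)%:E)%E).
      apply: ge0_le_integral => //.
      - by move=> x _; rewrite lee_fin normal_pdf_ge0.
      - apply/measurable_EFinP/measurable_funTS; exact: measurable_normal_pdf.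
      - by move=> x _; rewrite lee_fin normal_pdf_ub.
    have -> : (\int[mu]_(x in I) (normal_peak s)%:E = (normal_peak s * s)%:E)%E.
      rewrite integral_cst// EFinM; congr (_ * _)%E; exact: muI.
    by rewrite lee_fin normal_peak_le.
  have mXI : measurable (X @^-1` I) by have := mX measurableT I mI; rewrite setTI.
  have PIC : ((2^-1)%:E <= P (~` (X @^-1` I)))%E.
    rewrite probability_setC// leeBrDr ?fin_num_measure//.
    rewrite (le_trans (leeD2l _ PI))// -EFinD lee_fin; lra.
  have : ((s ^+ 2 / 4)%:E * P (~` (X @^-1` I)) <= v%:E)%E.
    have mC : measurable (~` (X @^-1` I)) by exact: measurableC.
    rewrite -X2 -integral_cst//.
    apply: (@le_trans _ _ (\int[P]_(t in ~` (X @^-1` I)) (X t ^+ 2)%:E)%E).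
      apply: ge0_le_integral => //.
      - by move=> t _; rewrite lee_fin; have := sqr_ge0 s; lra.
      - by apply: measurable_funTS; exact: (measurableT_comp (mpow 2) mX).
      - move=> t; rewrite /I/= in_itv/= => /negP; rewrite negb_and -!leNgt.
        rewrite lee_fin => /orP[|] h; nra.
    apply: ge0_subset_integral => //.
    - exact: (measurableT_comp (mpow 2) mX).
    - by move=> t _; rewrite lee_fin sqr_ge0.
  move=> /(le_trans (lee_wpmul2l _ PIC)); rewrite -EFinM !lee_fin => h.
  have := h (divr_ge0 (sqr_ge0 s) (ler0n _ 4)); lra.
have mX2 : measurable_fun setT (fun t => (X t ^+ 2)%:E).
  exact: (measurableT_comp (mpow 2) mX).
have mXm4 : measurable_fun setT (fun t => ((X t - m) ^+ 4)%:E).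
  by apply/measurable_EFinP/measurable_funX/measurable_funB.
have Xm4_ge0 t : (0 <= ((X t - m) ^+ 4)%:E)%E by rewrite lee_fin exprn_even_ge0.
have intP (r : R) : (\int[P]_t r%:E = r%:E)%E.
  by rewrite integral_cst//= probability_setT mule1.
(* Integrates [m ^ 2 <= 2 X ^ 2 + 2 (X - m)^2], where [2 (X - m)^2 <= s ^ 2 + (X - m)^4 / s ^ 2]
   trades the centred second moment for the fourth one already bounded. The total [2 + 65 * 8 = 522]
   is below [23 ^ 2]. *)
have m2 : m ^+ 2 <= 23 ^+ 2 * v.
  have : ((m ^+ 2)%:E <= 2%:E * v%:E + ((s ^+ 2)%:E + (s ^- 2)%:E * (64 * s ^+ 4)%:E))%E.
    rewrite -X2 -(intP (m ^+ 2)).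
    apply: (@le_trans _ _ (\int[P]_t (2%:E * (X t ^+ 2)%:E +
        ((s ^+ 2)%:E + (s ^- 2)%:E * ((X t - m) ^+ 4)%:E)))%E).
      apply: ge0_le_integral => //.
      - by move=> t _; rewrite lee_fin sqr_ge0.
      - apply: emeasurable_funD; first exact: emeasurable_funM.
        by apply: emeasurable_funD => //; exact: emeasurable_funM.
      - move=> t _; rewrite -!EFinM -!EFinD lee_fin.
        have s2 : 0 < s ^+ 2 by rewrite exprn_gt0.
        rewrite (_ : (X t - m) ^+ 4 = (X t - m) ^+ 2 * (X t - m) ^+ 2); last by ring.
        move: (X t) => y.
        have : 2 * (y - m) ^+ 2 <= s ^+ 2 + s ^- 2 * ((y - m) ^+ 2 * (y - m) ^+ 2).
          rewrite (_ : s ^+ 2 + _ = 2 * (y - m) ^+ 2 + s ^- 2 * (s ^+ 2 - (y - m) ^+ 2) ^+ 2).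
            by rewrite lerDl mulr_ge0 ?sqr_ge0// invr_ge0 ltW.
          by field.
        by have := sqr_ge0 (2 * y - m); nra.
    rewrite ge0_integralD//; last 4 first.
    - by move=> t _; rewrite -EFinM lee_fin mulr_ge0 ?sqr_ge0.
    - exact: emeasurable_funM.
    - move=> t _; apply: adde_ge0; first by rewrite lee_fin sqr_ge0.
      by apply: mule_ge0 => //; rewrite lee_fin invr_ge0 sqr_ge0.
    - by apply: emeasurable_funD => //; exact: emeasurable_funM.
    rewrite ge0_integralZl_EFin//; last by move=> t _; rewrite lee_fin sqr_ge0.
    apply: leeD2l; rewrite ge0_integralD//; last 3 first.
    - by move=> t _; rewrite lee_fin sqr_ge0.
    - by move=> t _; apply: mule_ge0 => //; rewrite lee_fin invr_ge0 sqr_ge0.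
    - exact: emeasurable_funM.
    rewrite intP leeD2l//.
    rewrite ge0_integralZl_EFin ?invr_ge0 ?sqr_ge0// lee_wpmul2l//.
    by rewrite lee_fin invr_ge0 sqr_ge0.
  rewrite -!EFinM -!EFinD lee_fin (_ : s ^- 2 * (64 * s ^+ 4) = 64 * s ^+ 2); last first.
    by field.
  by lra.
(* With [s ^ 4 <= (8 v)^2] and [m ^ 4 <= (23 ^ 2 v)^2] this gives the two summands of the final
   constant. *)
have X4 t : X t ^+ 4 <= 8 * (X t - m) ^+ 4 + 8 * m ^+ 4.
  move: (X t) => y; have [z ->] : exists z, y = z + m by exists (y - m); ring.
  rewrite addrK.
  rewrite (_ : 8 * z ^+ 4 + 8 * m ^+ 4 = (z + m) ^+ 4 + (z - m) ^+ 2 *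
    (5 * (z + m) ^+ 2 + 2 * z ^+ 2 + 2 * m ^+ 2)); last by ring.
  rewrite lerDl mulr_ge0 ?sqr_ge0//.
  by have := sqr_ge0 (z + m); have := sqr_ge0 z; have := sqr_ge0 m; lra.
have -> : (8 * (64 * 8 ^+ 2) + 8 * (23 ^+ 2) ^+ 2) * v ^+ 2 =
  8 * (64 * (8 * v) ^+ 2) + 8 * (23 ^+ 2 * v) ^+ 2 by ring.
apply: (@le_trans _ _ (\int[P]_t (8%:E * ((X t - m) ^+ 4)%:E + (8 * m ^+ 4)%:E))%E).
  apply: ge0_le_integral => //.
  - by move=> t _; rewrite lee_fin exprn_even_ge0.
  - exact: (measurableT_comp (mpow 4) mX).
  - by apply: emeasurable_funD => //; exact: emeasurable_funM.
  - by move=> t _; rewrite -EFinM -EFinD lee_fin.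
rewrite ge0_integralD//; last 3 first.
- by move=> t _; rewrite mule_ge0.
- exact: emeasurable_funM.
- by move=> t _; rewrite lee_fin mulr_ge0// exprn_even_ge0.
rewrite intP ge0_integralZl_EFin//.
apply: (@le_trans _ _ (8%:E * (64 * s ^+ 4)%:E + (8 * m ^+ 4)%:E)%E).
  by rewrite leeD2r// lee_wpmul2l.
rewrite -EFinM -EFinD lee_fin lerD// ?ler_wpM2l//.
  by rewrite (exprM s 2 2) lerXn2r ?nnegrE ?sqr_ge0// mulr_ge0.
by rewrite (exprM m 2 2) lerXn2r ?nnegrE ?sqr_ge0// mulr_ge0// sqr_ge0.
Qed.

End normal_moments.

(** * Noise sources *)

Section noise.
Context (d : measure_display) (T : measurableType d) (R : realType)
  (P : probability T R) (I : finType) (G : I -> nat -> set (set T)).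
Hypothesis Gsigma : forall i k, sigma_algebra setT (G i k).
Hypothesis Gmeas : forall i k, G i k `<=` measurable.
Hypothesis Gin : forall i, mutually_independent P (G i).
Hypothesis Gout : mutually_independent P
  (fun i => <<s \bigcup_(k in [set: nat]) G i k >>).

(* everything except the source [i] from time [n] on *)
Definition others i n : set (set T) :=
  \bigcup_(j in [set j | j.1 != i \/ (j.2 < n)%N]) G j.1 j.2.

Definition mx_adapted H (r c : nat) (X : T -> 'M[R]_(r, c)) :=
  forall a b, adapted H (fun t => X t a b).

Lemma others_measurable i n : others i n `<=` measurable.
Proof. by move=> A [j _]; exact: Gmeas. Qed.

Lemma others_mono i n : others i n `<=` <<s others i n.+1 >>.
Proof.
move=> A [j jn GA]; apply: sub_sigma_algebra; exists j => //=.
by case: jn => jn; [left|right; rewrite ltnW].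
Qed.

Lemma mx_adapted_others i n j k r c (X : T -> 'M[R]_(r, c)) :
  j != i \/ (k < n)%N -> mx_adapted (G j k) X -> mx_adapted (others i n) X.
Proof.
move=> jk aX a b; apply: adaptedS (aX a b) => A GA.
by apply: sub_sigma_algebra; exists (j, k).
Qed.

Lemma sigma_vec_adapted r (X : T -> 'cV[R]_r) : mx_adapted (sigma_vec X) X.
Proof.
move=> a b _ U mU; apply: sub_sigma_algebra; apply: sub_sigma_algebra.
by exists a => //; exists U => //; rewrite (ord1 b).
Qed.

Section source.
Variables (i : I) (r : nat) (S : 'M[R]_r) (X : nat -> T -> 'cV[R]_r).
Hypothesis GX : forall k, G i k = sigma_vec (X k).
Hypothesis gX : forall k, centered_gaussian P S (X k).
Variable l : nat.

(** The lag [l] allows a multiplier of index [n] to be paired with the source value [l] steps later,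
    while it may use all values of the source before that. *)
Let H n := others i (n + l)%N.
Let x n a t := X (n + l)%N t a 0.

Let x_adapted n a : adapted (G i (n + l)%N) (x n a).
Proof. by rewrite GX; exact: (@sigma_vec_adapted _ (X (n + l)%N) a 0). Qed.

Let H_adapted n (Y : T -> R) : adapted (G i (n + l)%N) Y -> adapted (H n.+1) Y.
Proof.
move=> aY; apply: adaptedS aY => A GA; apply: sub_sigma_algebra.
by exists (i, (n + l)%N) => //=; right; rewrite addSn.
Qed.

(** Stated for anything read off the current source value, because centred products of coordinates
    are needed as well as the coordinates. *)
Let H_indep n A U (Y : T -> R) : adapted (G i (n + l)%N) Y ->
  <<s H n >> A -> measurable U ->
  P (A `&` Y @^-1` U) = (P A * P (Y @^-1` U))%E.
Proof.
move=> aY HA mU.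
apply: (@sigma_family_indep _ _ _ P I G Gsigma Gmeas Gin Gout
  [set j | j.1 != i \/ (j.2 < n + l)%N] i (n + l)%N) => //=.
  by move=> [|]; [rewrite eqxx|rewrite ltnn].
by rewrite -(measurable_g_measurableTypeE (@Gsigma i (n + l)%N)); exact: adapted_preimage.
Qed.

Let x_measurable n a : measurable_fun setT (x n a).
Proof. by apply: adapted_measurable (@x_adapted n a); exact: Gmeas. Qed.

Let x_mean n a : (\int[P]_t (x n a t)%:E = 0)%E.
Proof. by have [_ /(_ a) + _] := gX (n + l)%N; rewrite unlock. Qed.

Let x_cov n a b : (\int[P]_t (x n a t * x n b t)%:E = (S a b)%:E)%E.
Proof.
have [_ E0 /(_ a b)] := gX (n + l)%N; rewrite covariance.unlock !E0/= expectation.unlock => <-.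
by apply: eq_integral => t _; rewrite !fctE /= !subr0.
Qed.

Let x_sqr n a : (\int[P]_t (x n a t ^+ 2)%:E = (S a a)%:E)%E.
Proof. by rewrite -(x_cov n); apply: eq_integral => t _; rewrite expr2. Qed.

Let M : R := 8 * (64 * 8 ^+ 2) + 8 * (23 ^+ 2) ^+ 2.

Let x_moment4 n a : (\int[P]_t (x n a t ^+ 4)%:E <= (M * S a a ^+ 2)%:E)%E.
Proof.
have [[_ /(_ (delta_mx a 0))[m [s [s0 law]]]] _ _] := gX (n + l)%N.
apply: (@normal_law_moment4 _ _ _ P (x n a) m s) => // U mU.
rewrite -law//; congr (P (_ @^-1` U)); apply/funext => t.
rewrite mxE (bigD1 a)//= big1 ?addr0; last first.
  by move=> j ja; rewrite !mxE (negbTE ja)/= mul0r.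
by rewrite !mxE !eqxx/= mul1r.
Qed.

Let H_measurable n : H n `<=` measurable. Proof. exact: others_measurable. Qed.

Let H_mono n : H n `<=` <<s H n.+1 >>.
Proof. by rewrite /H addSn; exact: others_mono. Qed.

Let x_integrable n a b : P.-integrable setT (fun t => (x n a t * x n b t)%:E).
Proof.
apply: square_integrableM; split => //; under eq_integral do rewrite ?x_sqr;
  by rewrite x_sqr ltry.
Qed.

Let centered_product_sqr n a b :
  (\int[P]_t ((x n a t * x n b t - S a b) ^+ 2)%:E <=
   (M * S a a ^+ 2 + M * S b b ^+ 2 + 2 * S a b ^+ 2)%:E)%E.
Proof.
have mx4 c : measurable_fun setT (fun t => (x n c t ^+ 4)%:E).
  by apply/measurable_EFinP/measurable_funX.
apply: (@le_trans _ _ (\int[P]_t ((x n a t ^+ 4)%:E + (x n b t ^+ 4)%:E +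
    (2 * S a b ^+ 2)%:E))%E).
  apply: ge0_le_integral => //.
  - by move=> t _; rewrite lee_fin sqr_ge0.
  - apply/measurable_EFinP/measurable_funX/measurable_funB => //.
    exact: measurable_funM.
  - by do 2 apply: emeasurable_funD => //.
  - move=> t _; rewrite -!EFinD lee_fin.
    (* Adding [(y z + s)^2] to the left side gives [2 y^2 z^2 + 2 s^2], at most
       [y^4 + z^4 + 2 s^2]. *)
    move: (x n a t) (x n b t) (S a b) => y z s.
    rewrite (_ : y ^+ 4 = y ^+ 2 * y ^+ 2); last by ring.
    rewrite (_ : z ^+ 4 = z ^+ 2 * z ^+ 2); last by ring.
    by have := sqr_ge0 (y * z + s); have := sqr_ge0 (y ^+ 2 - z ^+ 2); nra.
have x4_ge0 c t : (0 <= (x n c t ^+ 4)%:E)%E by rewrite lee_fin exprn_even_ge0.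
rewrite ge0_integralD//; last 3 first.
- by move=> t _; rewrite adde_ge0.
- exact: emeasurable_funD.
- by move=> t _; rewrite lee_fin mulr_ge0 ?sqr_ge0.
rewrite ge0_integralD// integral_cst//= probability_setT mule1 !EFinD.
by apply: leeD => //; exact: leeD.
Qed.

Let noise_covariance_average1 a b : {ae P, forall t,
  average (fun n => x n a t * x n b t) N @[N --> \oo] --> S a b}.
Proof.
pose y n t := x n a t * x n b t - S a b.
have ay n : adapted (G i (n + l)%N) (y n).
  apply: adaptedD; last exact: adapted_cst.
  exact: adaptedM (@x_adapted n a) (@x_adapted n b).
have := @martingale_average _ _ _ P H y
  (M * S a a ^+ 2 + M * S b b ^+ 2 + 2 * S a b ^+ 2) H_measurable H_mono
  (fun n => H_adapted (@ay n)) (fun n A U => H_indep (@ay n)) _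
  (fun n => centered_product_sqr n a b).
move=> h; apply: filterS (h _) => [t|n]; first exact: average_cvg_center.
rewrite /y; under eq_integral do rewrite EFinB.
rewrite integralB//; last exact: finite_measure_integrable_cst.
by rewrite x_cov integral_cst//= probability_setT mule1 subee.
Qed.

Lemma noise_covariance_average : {ae P, forall t, forall a b,
  average (fun n => X (n + l)%N t a 0 * X (n + l)%N t b 0) N @[N --> \oo] --> S a b}.
Proof.
apply: filter_forall => a; apply: filter_forall => b.
exact: noise_covariance_average1.
Qed.

(** The power bound stands inside the almost sure statement, to be supplied path by path; no moment
    of [V] is required. *)
Lemma noise_predictable_average c (V : nat -> T -> 'cV[R]_c) :
  (forall n, mx_adapted (H n) (V n)) ->
  {ae P, forall t,
    (exists K : R, forall N, \sum_(n < N) \sum_a V n t a 0 ^+ 2 <= K * N%:R) ->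
    forall a b, average (fun n => V n t a 0 * X (n + l)%N t b 0) N @[N --> \oo] --> 0}.
Proof.
move=> aV.
suff : {ae P, forall t a b,
    (exists K : R, forall N, \sum_(n < N) \sum_a V n t a 0 ^+ 2 <= K * N%:R) ->
    average (fun n => V n t a 0 * X (n + l)%N t b 0) N @[N --> \oo] --> 0}.
  by apply: filterS => t h K a b; exact: h.
apply: filter_forall => a; apply: filter_forall => b.
have := @martingale_transform_average _ _ _ P H (x ^~ b) (S b b) H_measurable H_mono
  (fun n => H_adapted (@x_adapted n b)) (fun n A U => H_indep (@x_adapted n b))
  (x_mean ^~ b) _ (fun n t => V n t a 0) (fun n => @aV n a 0).
move=> h; apply: filterS (h _ _).
- move=> t ht [K hK]; apply: ht; exists K => N; apply: le_trans (hK N).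
  apply: ler_sum => n _; rewrite (bigD1 a)//= lerDl sumr_ge0// => j _; exact: sqr_ge0.
- by move=> n; rewrite x_sqr.
- apply: filterS (noise_covariance_average1 b b) => t ht; exists (S b b).
  by apply: cvg_trans ht; apply: near_eq_cvg; apply: nearW => N; rewrite /average.
Qed.

End source.
End noise.

(** * Stable recursions *)

Section stable_filter.
Context (R : realType).
Local Open Scope complex_scope.
Implicit Types (q g : nat -> R) (z w : R[i]).

(* size classes of nonnegative sequences that a contractive scalar filter
   does not leave *)
Record filter_class (Q : (nat -> R) -> Prop) : Prop := FilterClass {
  filter_class_le : forall c q q', 0 <= c -> (forall n, 0 <= q' n <= c * q n) ->
    Q q -> Q q';
  filter_classD : forall q q', Q q -> Q q' -> Q (fun n => q n + q' n);
  filter_class_contract : forall r q g, 0 <= r < 1 -> (forall n, 0 <= q n) ->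
    (forall n, 0 <= g n) -> (forall n, q n.+1 <= r * q n + g n) -> Q g -> Q q }.

(** Squared modulus as an element of [R], so that energies of complex vectors are real sequences. *)
Definition sqrc z : R := complex.Re z ^+ 2 + complex.Im z ^+ 2.

Lemma sqrc_ge0 z : 0 <= sqrc z. Proof. by rewrite addr_ge0 ?sqr_ge0. Qed.

Lemma sqrc_real (x : R) : sqrc x%:C = x ^+ 2.
Proof. by rewrite /sqrc/= expr0n addr0. Qed.

Lemma sqrcM z w : sqrc (z * w) = sqrc z * sqrc w.
Proof. by case: z w => [a b] [c e]; rewrite /sqrc/=; ring. Qed.

Lemma sqrcD_le z w : sqrc (z + w) <= 2 * sqrc z + 2 * sqrc w.
Proof.
case: z w => [a b] [c e]; rewrite /sqrc/=.
by have := sqr_ge0 (a - c); have := sqr_ge0 (b - e); nra.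
Qed.

(** Convexity of the square: [r b + c] is the mean of [b] and [c / (1 - r)] with weights [r] and
    [1 - r]. The energy thus obeys a contractive scalar recursion with the same [r]. *)
Lemma sqrc_contract z v w : Num.sqrt (sqrc z) < 1 ->
  sqrc (z * v + w) <= Num.sqrt (sqrc z) * sqrc v + sqrc w / (1 - Num.sqrt (sqrc z)).
Proof.
set r := Num.sqrt (sqrc z) => r1.
have r0 : 0 <= r by exact: sqrtr_ge0.
have nE u : `|u| = (Num.sqrt (sqrc u))%:C by rewrite normc_def.
have sE u : sqrc u = Num.sqrt (sqrc u) ^+ 2 by rewrite sqr_sqrtr ?sqrc_ge0.
have : Num.sqrt (sqrc (z * v + w)) <= r * Num.sqrt (sqrc v) + Num.sqrt (sqrc w).
  by rewrite -lecR rmorphD rmorphM/= -!nE -normrM ler_normD.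
move=> xbc; rewrite (sE (z * v + w)) (sE v) (sE w); move: xbc.
move: (sqrtr_ge0 (sqrc (z * v + w))) (sqrtr_ge0 (sqrc v)) (sqrtr_ge0 (sqrc w)).
move: (Num.sqrt (sqrc (z * v + w))) (Num.sqrt (sqrc v)) (Num.sqrt (sqrc w)) => x b c.
move=> x0 b0 c0 xbc.
have r1' : 0 < 1 - r by rewrite subr_gt0.
apply: (@le_trans _ _ ((r * b + c) ^+ 2)).
  by apply: lerXn2r => //; exact: addr_ge0 (mulr_ge0 r0 b0) c0.
rewrite -subr_ge0 (_ : _ - _ = r * ((1 - r) * b - c) ^+ 2 / (1 - r)).
  by apply: divr_ge0; [apply: mulr_ge0 => //; exact: sqr_ge0|exact: ltW].
by field; rewrite gt_eqF.
Qed.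

Definition vsqrc p (v : 'cV[R[i]]_p) : R := \sum_i sqrc (v i 0).

Lemma vsqrc_ge0 p (v : 'cV[R[i]]_p) : 0 <= vsqrc v.
Proof. by apply: sumr_ge0 => i _; exact: sqrc_ge0. Qed.

Lemma vsqrcD_le p (v w : 'cV[R[i]]_p) : vsqrc (v + w) <= 2 * vsqrc v + 2 * vsqrc w.
Proof.
rewrite /vsqrc !mulr_sumr -big_split/=; apply: ler_sum => i _.
by rewrite mxE sqrcD_le.
Qed.

Lemma vsqrc_contract p z (v w : 'cV[R[i]]_p) : Num.sqrt (sqrc z) < 1 ->
  vsqrc (z *: v + w) <=
  Num.sqrt (sqrc z) * vsqrc v + vsqrc w / (1 - Num.sqrt (sqrc z)).
Proof.
move=> z1; rewrite /vsqrc mulr_sumr mulr_suml -big_split/=.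
by apply: ler_sum => i _; rewrite !mxE sqrc_contract.
Qed.

Lemma vsqrc_mulmx_le m p (M : 'M[R[i]]_(m, p)) :
  exists2 c : R, 0 <= c & forall v, vsqrc (M *m v) <= c * vsqrc v.
Proof.
have sum_le (I : Type) (r : seq I) (f : I -> R[i]) :
    exists2 c : R, 0 <= c & forall g : I -> R[i],
      sqrc (\sum_(i <- r) f i * g i) <= c * \sum_(i <- r) sqrc (g i).
  elim: r => [|i r [c c0 IH]].
    by exists 0 => // g; rewrite !big_nil mulr0 /sqrc/= expr0n addr0.
  exists (2 * sqrc (f i) + 2 * c); first by rewrite addr_ge0 ?mulr_ge0 ?sqrc_ge0.
  move=> g; rewrite !big_cons; apply: le_trans (sqrcD_le _ _) _.
  have := IH g; rewrite sqrcM.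
  have : 0 <= \sum_(j <- r) sqrc (g j) by apply: sumr_ge0 => j _; exact: sqrc_ge0.
  move: (sqrc_ge0 (f i)) (sqrc_ge0 (g i)); move: (\sum_(j <- r) _) => s.
  by move: (sqrc _) (sqrc _) (sqrc _) => a b e; nra.
have /choice[c cP] : forall i, exists c : R, 0 <= c /\ forall v,
    sqrc ((M *m v) i 0) <= c * vsqrc v.
  move=> i; have [c c0 h] := sum_le _ (index_enum 'I_p) (M i).
  by exists c; split => // v; rewrite mxE h.
exists (\sum_i c i); first by apply: sumr_ge0 => i _; have [] := cP i.
move=> v; rewrite /vsqrc mulr_suml; apply: ler_sum => i _.
by have [_] := cP i; apply.
Qed.

Lemma stable_filter_complex Q p (M : 'M[R[i]]_p) (a f : nat -> 'cV[R[i]]_p) :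
  filter_class Q -> (forall z, eigenvalue M z -> `|z| < 1) ->
  (forall n, a n.+1 = M *m a n + f n) ->
  Q (fun n => vsqrc (f n)) -> Q (fun n => vsqrc (a n)).
Proof.
case=> Qle QD Qc; case: p M a f => [|p] M a f M1 aE Qf.
  apply: (Qle 0 (fun n => vsqrc (f n))) => // n.
  by rewrite /vsqrc big_ord0 mul0r lexx.
have Qmul m (L : 'M[R[i]]_(m, p.+1)) b : Q (fun n => vsqrc (b n)) ->
    Q (fun n => vsqrc (L *m b n)).
  have [c c0 h] := vsqrc_mulmx_le L.
  by apply: (Qle c) => // n; rewrite vsqrc_ge0 h.
have QDv m (b c : nat -> 'cV[R[i]]_m) : Q (fun n => vsqrc (b n)) -> Q (fun n => vsqrc (c n)) ->
    Q (fun n => vsqrc (b n + c n)).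
  move=> Qb Qc'; apply: (Qle 2 (fun n => vsqrc (b n) + vsqrc (c n))) => // [n|].
    by rewrite vsqrc_ge0 mulrDr vsqrcD_le.
  exact: QD.
(* One root is removed at a time. If [L] is the product over the other roots, [L a] follows the
   scalar recursion with multiplier [z] driven by [(M - z) L a + L f], already of class [Q]. The
   chain starts at the full product, which is 0 by Cayley-Hamilton. *)
have main (rs : seq R[i]) : (forall z, z \in rs -> `|z| < 1) ->
    Q (fun n => vsqrc (horner_mx M (\prod_(z <- rs) ('X - z%:P)) *m a n)) ->
    Q (fun n => vsqrc (a n)).
  elim: rs => [_|z rs IH zrs].
    by rewrite big_nil rmorph1; apply: (Qle 1) => // n; rewrite mul1r mul1mx vsqrc_ge0 lexx.
  rewrite big_cons rmorphM/= rmorphB/= horner_mx_X horner_mx_C.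
  set L := horner_mx M _ => QL; apply: IH; first by move=> w wrs; apply: zrs; rewrite inE wrs orbT.
  rewrite -/L; have LM : L *m M = M *m L.
    by apply: comm_horner_mx.
  have z1 : Num.sqrt (sqrc z) < 1.
    by rewrite -ltcR -[(Num.sqrt _)%:C]normc_def zrs ?mem_head.
  set r := Num.sqrt (sqrc z) in z1.
  apply: (Qc r _ (fun n => vsqrc ((M - z%:M) * L *m a n + L *m f n) / (1 - r))).
  - by rewrite sqrtr_ge0.
  - by move=> n; exact: vsqrc_ge0.
  - by move=> n; rewrite divr_ge0 ?vsqrc_ge0// subr_ge0 ltW.
  - move=> n; rewrite aE mulmxDr mulmxA LM -mulmxA.
    rewrite (_ : _ + _ = z *: (L *m a n) + ((M - z%:M) * L *m a n + L *m f n)).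
      exact: vsqrc_contract.
    by rewrite -mulmxE mulmxBl !mulmxBl mul_scalar_mx -scalemxAl -!mulmxA addrA addrCA subrr addr0.
  - apply: (Qle (1 - r)^-1 (fun n => vsqrc ((M - z%:M) * L *m a n + L *m f n))).
    + by rewrite invr_ge0 subr_ge0 ltW.
    + move=> n; apply/andP; split; last by rewrite mulrC.
      by apply: divr_ge0; [exact: vsqrc_ge0|rewrite subr_ge0 ltW].
    + by apply: QDv => //; exact: Qmul.
have [rs rsE] := closed_field_poly_normal (char_poly M).
rewrite (monicP (char_poly_monic M)) scale1r in rsE.
apply: (main rs) => [z zrs|].
  by apply: M1; rewrite eigenvalue_root_char rsE root_prod_XsubC.
rewrite -rsE Cayley_Hamilton; apply: (Qle 0 (fun n => vsqrc (f n))) => // n.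
rewrite mul0mx mul0r /vsqrc big1 ?lexx// => i _.
by rewrite mxE /sqrc/= expr0n addr0.
Qed.

Definition energy p (v : 'cV[R]_p) : R := \sum_i v i 0 ^+ 2.

Lemma stable_filter Q p (M : 'M[R]_p) (a f : nat -> 'cV[R]_p) :
  filter_class Q -> schur_stable M ->
  (forall n, a n.+1 = M *m a n + f n) ->
  Q (fun n => energy (f n)) -> Q (fun n => energy (a n)).
Proof.
move=> QC M1 aE.
have eE (b : nat -> 'cV[R]_p) : (fun n => energy (b n)) =
    (fun n => vsqrc (map_mx (real_complex R) (b n))).
  apply/funext => n; rewrite /vsqrc; apply: eq_bigr => i _.
  by rewrite mxE sqrc_real.
rewrite !eE; apply: stable_filter_complex QC M1 _ => n.
by rewrite aE map_mxD map_mxM.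
Qed.

End stable_filter.

(** * Size classes preserved by stable recursions *)

Section size_classes.
Context (R : realType).
Implicit Types (q g : nat -> R).

Definition bounded_power q := exists K : R, forall N, \sum_(n < N) q n <= K * N%:R.
Definition vanishing q := q n @[n --> \oo] --> 0.
(** The second clause pays for the boundary term when an average is shifted by one step. *)
Definition tame q := bounded_power q /\ vanishing (fun n => q n / n.+1%:R).

Lemma bounded_power_class : filter_class bounded_power.
Proof.
split=> [c q q' c0 qq' [K hK]|q q' [K hK] [K' hK']|r q g /andP[r0 r1] q0 g0 qg [K hK]].
- exists (c * K) => N; rewrite -mulrA.
  apply: (@le_trans _ _ (c * \sum_(n < N) q n)); last by apply: ler_wpM2l.
  by rewrite mulr_sumr; apply: ler_sum => n _; have /andP[] := qq' n.
- by exists (K + K') => N; rewrite big_split/= mulrDl lerD ?hK ?hK'.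
- have r1' : 0 < 1 - r by rewrite subr_gt0.
  have K0 : 0 <= K.
    by have := hK 1; rewrite big_ord_recl big_ord0 addr0 mulr1; exact: le_trans.
  (* The solution of [K' = r K' + q 0 + K], the level that the recursion reproduces. *)
  exists ((q 0%N + K) / (1 - r)) => N.
  set K' := (q 0%N + K) / (1 - r).
  have K'E : K' * (1 - r) = q 0%N + K by rewrite divfK// gt_eqF.
  have K'0 : 0 <= K' by apply: divr_ge0; [exact: addr_ge0|exact: ltW].
  elim: N => [|N IH]; first by rewrite big_ord0 mulr0.
  rewrite big_ord_recl/=.
  apply: (@le_trans _ _ (q 0%N + (r * \sum_(n < N) q n + \sum_(n < N) g n))).
    by rewrite lerD2l mulr_sumr -big_split/=; apply: ler_sum => n _; exact: qg.
  have hN : 0 <= N%:R :> R by [].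
  have := hK N; have := ler_wpM2l r0 IH; rewrite -natr1 mulrDr mulr1.
  have q00 := q0 0%N; move: (\sum_(i < N) q i) (\sum_(i < N) g i) => x y rx yK.
  nra.
Qed.

Lemma vanishing_class : filter_class vanishing.
Proof.
split=> [c q q' c0 qq' qv|q q' qv qv'|r q g /andP[r0 r1] q0 g0 qg gv].
- apply: (@squeeze_cvgr _ _ _ _ (cst 0) (fun n => c * q n)).
  + by apply: nearW => n; exact: qq'.
  + exact: cvg_cst.
  + by rewrite -[X in _ --> X](mulr0 c); apply: cvgM => //; exact: cvg_cst.
- by rewrite /vanishing -[X in _ --> X]addr0; exact: cvgD.
- have r1' : 0 < 1 - r by rewrite subr_gt0.
  apply/cvgrPdist_lt => e e0.
  (* A forcing of this size keeps the level [e / 2] fixed, since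
     [r (e / 2) + e (1 - r) / 2 = e / 2]; the other half of [e] absorbs the decaying initial
     value. *)
  have e2 : 0 < e * (1 - r) / 2 by rewrite divr_gt0// mulr_gt0.
  have /cvgrPdist_lt/(_ _ e2)[N0 _ hN0] := gv.
  have hq k : q (N0 + k)%N <= r ^+ k * q N0 + e / 2.
    elim: k => [|k IH]; first by rewrite addn0 expr0 mul1r lerDl divr_ge0// ltW.
    rewrite addnS (le_trans (qg _))//.
    have : g (N0 + k)%N <= e * (1 - r) / 2.
      have := hN0 (N0 + k)%N (leq_addr _ _); rewrite /= sub0r normrN => h.
      exact: (le_trans (ler_norm _) (ltW h)).
    have := ler_wpM2l r0 IH.
    have -> : r ^+ k.+1 * q N0 = r * (r ^+ k * q N0) by rewrite exprS mulrA.
    rewrite mulrDr => h1 h2; apply: le_trans (lerD h1 h2) _.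
    by rewrite -addrA lerD2l; lra.
  have : r ^+ k * q N0 @[k --> \oo] --> (0 : R).
    rewrite -[X in _ --> X](mul0r (q N0)); apply: cvgM; last exact: cvg_cst.
    by apply: cvg_expr; rewrite ger0_norm.
  have e2' : 0 < e / 2 by rewrite divr_gt0.
  move=> /cvgrPdist_lt/(_ _ e2')[k0 _ hk0].
  exists (N0 + k0)%N => // n /= hn.
  have nE : n = (N0 + (n - N0))%N by rewrite subnKC// (leq_trans (leq_addr _ _) hn).
  rewrite sub0r normrN ger0_norm// nE (le_lt_trans (hq _))// [ltRHS](splitr e) ltrD2r.
  have := hk0 (n - N0)%N; rewrite /= sub0r normrN => h.
  by apply: le_lt_trans (ler_norm _) (h _); rewrite leq_subRL// (leq_trans (leq_addr _ _) hn).
Qed.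

Lemma tame_class : filter_class tame.
Proof.
have [b1 b2 b3] := bounded_power_class; have [v1 v2 v3] := vanishing_class.
split=> [c q q' c0 qq' [qb qv]|q q' [qb qv] [qb' qv']|r q g r01 q0 g0 qg [gb gv]].
- split; first exact: (b1 c q q').
  apply: (v1 c _ _ c0 _ qv) => n; have /andP[q'0 q'c] := qq' n.
  by rewrite divr_ge0//= mulrA ler_wpM2r// invr_ge0.
- split; first exact: b2.
  by have := v2 _ _ qv qv'; congr vanishing; apply/funext => n; rewrite mulrDl.
- split; first exact: (b3 r q g).
  apply: (v3 r _ (fun n => g n / n.+1%:R)) => // n.
  + by rewrite divr_ge0.
  + by rewrite divr_ge0.
  + apply: (@le_trans _ _ (q n.+1 / n.+1%:R)).
      by rewrite ler_wpM2l// lef_pV2 ?posrE ?ltr0n// ler_nat.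
    by rewrite mulrA -mulrDl ler_wpM2r ?invr_ge0.
Qed.

(** A term is the difference of consecutive partial sums, so [q n / (n + 1)] is the average at
    [n + 1] minus [n / (n + 1)] times the average at [n], and tends to [l - l]. *)
Lemma average_cvg_tame q (l : R) : (forall n, 0 <= q n) ->
  average q N @[N --> \oo] --> l -> tame q.
Proof.
move=> q0 ql; split.
  have /cvgP/cvg_seq_bounded[K [_ /(_ (K + 1))]] := ql.
  rewrite ltrDl ltr01 => /(_ isT) hK.
  exists (K + 1) => -[|N]; first by rewrite big_ord0 mulr0.
  have := hK N.+1 I; rewrite /= => /(le_trans (ler_norm _)).
  by rewrite /average ler_pdivrMl ?ltr0n// mulrC.
have -> : (fun n => q n / n.+1%:R) =
    (fun n => average q n.+1 - (1 - n.+1%:R^-1) * average q n).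
  apply/funext => -[|n]; rewrite /average big_ord_recr/=.
    by rewrite big_ord0 invr1 subrr mul0r subr0 add0r mulrC.
  rewrite -[n.+2%:R]natr1.
  have : n.+1%:R != 0 :> R by rewrite pnatr_eq0.
  have : n.+1%:R + 1 != 0 :> R by rewrite natr1 pnatr_eq0.
  by move: (n.+1%:R : R) => x x1 x0; field; rewrite x0 x1.
rewrite /vanishing -[X in _ --> X](subrr l); apply: cvgB.
  apply: (cvg_comp _ _ _ ql); apply/cvgnyPge => A.
  by exists A => // n /= An; rewrite (leq_trans An).
rewrite -[l in X in _ --> X]mul1r; apply: cvgM => //.
rewrite -[X in _ --> X]subr0; apply: cvgB; first exact: cvg_cst.
exact: cvg_harmonic.
Qed.

End size_classes.

(** * Matrix correlations *)

Section matrix_limits.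
Context (R : realType).

Lemma cvg_sumr (I : Type) (r : seq I) (f : I -> nat -> R) (l : I -> R) :
  (forall i, f i n @[n --> \oo] --> l i) ->
  \sum_(i <- r) f i n @[n --> \oo] --> \sum_(i <- r) l i.
Proof.
move=> fl; elim: r => [|i r IH].
  by rewrite big_nil; under eq_cvg do rewrite big_nil; exact: cvg_cst.
by rewrite big_cons; under eq_cvg do rewrite big_cons; exact: cvgD.
Qed.

Definition mcvg r s (S : nat -> 'M[R]_(r, s)) (Q : 'M[R]_(r, s)) :=
  forall i j, S N i j @[N --> \oo] --> Q i j.

Lemma mcvg_cst r s (Q : 'M[R]_(r, s)) : mcvg (fun=> Q) Q.
Proof. by move=> i j; exact: cvg_cst. Qed.

Lemma mcvgD r s (S S' : nat -> 'M[R]_(r, s)) Q Q' :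
  mcvg S Q -> mcvg S' Q' -> mcvg (fun N => S N + S' N) (Q + Q').
Proof.
move=> h h' i j; rewrite mxE.
by under eq_cvg do rewrite mxE; exact: cvgD.
Qed.

Lemma mcvgN r s (S : nat -> 'M[R]_(r, s)) Q :
  mcvg S Q -> mcvg (fun N => - S N) (- Q).
Proof.
move=> h i j; rewrite mxE.
by under eq_cvg do rewrite mxE; exact: cvgN.
Qed.

Lemma mcvgB r s (S S' : nat -> 'M[R]_(r, s)) Q Q' :
  mcvg S Q -> mcvg S' Q' -> mcvg (fun N => S N - S' N) (Q - Q').
Proof. by move=> h /mcvgN; exact: mcvgD. Qed.

Lemma mcvg_tr r s (S : nat -> 'M[R]_(r, s)) Q :
  mcvg S Q -> mcvg (fun N => (S N)^T) Q^T.
Proof. by move=> h i j; rewrite mxE; under eq_cvg do rewrite mxE; exact: h. Qed.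

Lemma mcvgM r s t (S : nat -> 'M[R]_(r, s)) (S' : nat -> 'M[R]_(s, t)) Q Q' :
  mcvg S Q -> mcvg S' Q' -> mcvg (fun N => S N *m S' N) (Q *m Q').
Proof.
move=> h h' i j; rewrite mxE; under eq_cvg do rewrite mxE.
by apply: cvg_sumr => k; apply: cvgM; [exact: h|exact: h'].
Qed.

Lemma mcvg_mulmxl r s t (M : 'M[R]_(t, r)) (S : nat -> 'M[R]_(r, s)) Q :
  mcvg S Q -> mcvg (fun N => M *m S N) (M *m Q).
Proof. by move=> h; apply: mcvgM h; exact: mcvg_cst. Qed.

Lemma mcvg_mulmxr r s t (M : 'M[R]_(s, t)) (S : nat -> 'M[R]_(r, s)) Q :
  mcvg S Q -> mcvg (fun N => S N *m M) (Q *m M).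
Proof. by move=> h; apply: mcvgM => //; exact: mcvg_cst. Qed.

Arguments mcvg_mulmxl {r s t} M {S Q}.
Arguments mcvg_mulmxr {r s t} M {S Q}.

Lemma mcvg_unique r s (S : nat -> 'M[R]_(r, s)) Q Q' :
  mcvg S Q -> mcvg S Q' -> Q = Q'.
Proof.
move=> h h'; apply/matrixP => i j.
exact: (cvg_unique _ (h i j) (h' i j)).
Qed.

Lemma mcvg_eq r s (S S' : nat -> 'M[R]_(r, s)) Q :
  (forall N, S N = S' N) -> mcvg S Q -> mcvg S' Q.
Proof. by move=> SS'; have -> : S' = S by apply/funext => N; rewrite SS'. Qed.

Lemma mcvg_trace r (S : nat -> 'M[R]_r) Q :
  mcvg S Q -> \tr (S N) @[N --> \oo] --> \tr Q.
Proof. by move=> h; rewrite /mxtrace; apply: cvg_sumr => i; exact: h. Qed.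

(** Each column of the powers is an unforced stable recursion, to which the filter lemma applies
    with the class of vanishing sequences. *)
Lemma schur_powers r (F : 'M[R]_r) : schur_stable F ->
  mcvg (fun n => iter n (mulmx F) 1%:M) 0.
Proof.
move=> F1 i j; rewrite mxE.
have := @stable_filter _ _ _ F (fun n => iter n (mulmx F) 1%:M *m delta_mx j 0)
  (fun=> 0) (vanishing_class R) F1.
move=> h; apply: cvg0_sqr.
have e0 : vanishing (fun=> energy (0 : 'cV[R]_r)).
  rewrite /energy big1; first exact: cvg_cst.
  by move=> k _; rewrite mxE expr0n.
have := h _ e0; move=> {}h.
have {}h : vanishing (fun n => energy (iter n (mulmx F) 1%:M *m (delta_mx j 0 : 'cV_r))).
  by apply: h => n; rewrite addr0 /= mulmxA.
apply: (filter_class_le (vanishing_class R) ler01 _ h) => n.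
rewrite sqr_ge0 mul1r /energy (bigD1 i)//= -colE mxE lerDl sumr_ge0// => k _.
exact: sqr_ge0.
Qed.

Lemma iter_mulmxC r (F : 'M[R]_r) n :
  iter n (mulmx F) 1%:M *m F = F *m iter n (mulmx F) 1%:M.
Proof. by elim: n => [|n IH] /=; rewrite ?mul1mx ?mulmx1// -mulmxA IH. Qed.

Section lyapunov.
Variables (r s : nat) (F : 'M[R]_r) (G : 'M[R]_s).
Hypotheses (F1 : schur_stable F) (G1 : schur_stable G).

Let phi (X : 'M[R]_(r, s)) := X - F *m X *m G^T.

Let phi_linear : linear phi.
Proof.
move=> a X Y; rewrite /phi mulmxDr mulmxDl -scalemxAr -scalemxAl scalerBr.
by rewrite opprD addrACA.
Qed.
HB.instance Definition _ :=
  GRing.isLinear.Build R 'M[R]_(r, s) 'M[R]_(r, s) _ phi phi_linear.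

(** A kernel element equals [F ^ n X (G ^ n)^T] for every [n], which tends to 0. In finite dimension
    injectivity makes [phi] invertible. *)
Let phi_inj X : phi X = 0 -> X = 0.
Proof.
move/eqP; rewrite subr_eq0 => /eqP XE.
have XnE n : X = iter n (mulmx F) 1%:M *m X *m (iter n (mulmx G) 1%:M)^T.
  elim: n => [|n IH] /=; first by rewrite mul1mx trmx1 mulmx1.
  rewrite {1}IH {1}XE.
  by rewrite !mulmxA iter_mulmxC -!mulmxA -trmx_mul iter_mulmxC.
apply: (@mcvg_unique _ _ (fun=> X)); first exact: mcvg_cst.
apply: (@mcvg_eq _ _ _ (fun=> X) 0 (fun n => esym (XnE n))).
rewrite (_ : 0 = 0 *m X *m 0^T); last by rewrite !mul0mx.
by apply: mcvgM; [apply: mcvg_mulmxr|apply: mcvg_tr]; exact: schur_powers.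
Qed.

Let phi_unit : lin_mx phi \in unitmx.
Proof.
rewrite -row_free_unit; apply: inj_row_free => v.
rewrite -[v]vec_mxK mul_vec_lin => /(congr1 vec_mx).
by rewrite mxvecK linear0 => /phi_inj ->; rewrite linear0.
Qed.

Lemma lyapunov_solution Q : exists X, X = F *m X *m G^T + Q.
Proof.
exists (vec_mx (mxvec Q *m invmx (lin_mx phi))); set X := vec_mx _.
have : phi X = Q.
  by apply: (can_inj mxvecK); rewrite -mul_vec_lin vec_mxK mulmxKV.
by move=> <-; rewrite /phi addrC subrK.
Qed.

(** The inverse of [phi] is multiplication by a fixed matrix on vectorized arguments, hence
    continuous: convergence of [phi (S N)] forces that of [S N]. *)
Lemma lyapunov_cvg (S : nat -> 'M[R]_(r, s)) X :
  mcvg (fun N => S N - F *m S N *m G^T) (X - F *m X *m G^T) -> mcvg S X.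
Proof.
move=> h.
have cvec (Y : nat -> 'M[R]_(r, s)) Z : mcvg Y Z -> mcvg (fun N => mxvec (Y N)) (mxvec Z).
  move=> YZ i j; rewrite (ord1 i); case/mxvec_indexP: j => a b.
  by rewrite mxvecE; under eq_cvg do rewrite mxvecE; exact: YZ.
have SE N : mxvec (S N) = mxvec (phi (S N)) *m invmx (lin_mx phi).
  by rewrite -mul_vec_lin mulmxK.
have XE : mxvec X = mxvec (phi X) *m invmx (lin_mx phi) by rewrite -mul_vec_lin mulmxK.
have : mcvg (fun N => mxvec (S N)) (mxvec X).
  rewrite XE; apply: (mcvg_eq (fun N => esym (SE N))).
  by apply: mcvg_mulmxr; exact: cvec.
move=> hv i j; have := hv 0 (mxvec_index i j); rewrite mxvecE.
by under eq_cvg do rewrite mxvecE.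
Qed.

End lyapunov.

Definition cross_average r s (a : nat -> 'cV[R]_r) (b : nat -> 'cV[R]_s) N :=
  N%:R^-1 *: \sum_(n < N) a n *m (b n)^T.

Lemma cross_averageE r s (a : nat -> 'cV[R]_r) (b : nat -> 'cV[R]_s) N i j :
  cross_average a b N i j = average (fun n => a n i 0 * b n j 0) N.
Proof.
rewrite mxE summxE /average; congr (_ * _); apply: eq_bigr => n _.
by rewrite mxE big_ord1 !mxE.
Qed.

Definition correlates r s (a : nat -> 'cV[R]_r) (b : nat -> 'cV[R]_s) Q :=
  mcvg (cross_average a b) Q.

Section correlation.
Variables r s t : nat.
Implicit Types (a : nat -> 'cV[R]_r) (b : nat -> 'cV[R]_s).

Lemma correlatesT a b Q : correlates a b Q -> correlates b a Q^T.
Proof.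
move=> /mcvg_tr; apply: mcvg_eq => N.
rewrite /cross_average linearZ/= linear_sum/=; congr (_ *: _).
by apply: eq_bigr => n _; rewrite trmx_mul trmxK.
Qed.

Lemma correlatesMl (M : 'M[R]_(t, r)) a b Q :
  correlates a b Q -> correlates (fun n => M *m a n) b (M *m Q).
Proof.
move=> /(mcvg_mulmxl M); apply: mcvg_eq => N.
rewrite /cross_average -scalemxAr mulmx_sumr; congr (_ *: _).
by apply: eq_bigr => n _; rewrite mulmxA.
Qed.

Lemma correlatesDl a a' b Q Q' : correlates a b Q -> correlates a' b Q' ->
  correlates (fun n => a n + a' n) b (Q + Q').
Proof.
move=> h h'; apply: mcvg_eq (mcvgD h h') => N.
rewrite /cross_average -scalerDr -big_split/=; congr (_ *: _).
by apply: eq_bigr => n _; rewrite mulmxDl.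
Qed.

Lemma correlatesNl a b Q : correlates a b Q -> correlates (fun n => - a n) b (- Q).
Proof.
move=> h; apply: mcvg_eq (mcvgN h) => N.
rewrite /cross_average -scalerN -sumrN; congr (_ *: _).
by apply: eq_bigr => n _; rewrite mulNmx.
Qed.

Lemma correlates_eq a a' b b' Q : (forall n, a n = a' n) -> (forall n, b n = b' n) ->
  correlates a b Q -> correlates a' b' Q.
Proof.
move=> aa bb; apply: mcvg_eq => N; rewrite /cross_average; congr (_ *: _).
by apply: eq_bigr => n _; rewrite aa bb.
Qed.

End correlation.
Arguments correlatesMl {r s t} M {a b Q}.

Lemma correlatesBl r s (a a' : nat -> 'cV[R]_r) (b : nat -> 'cV[R]_s) Q Q' :
  correlates a b Q -> correlates a' b Q' ->
  correlates (fun n => a n - a' n) b (Q - Q').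
Proof. by move=> h /correlatesNl; exact: correlatesDl. Qed.

Lemma correlatesMr r s t (M : 'M[R]_(t, s)) (a : nat -> 'cV[R]_r)
    (b : nat -> 'cV[R]_s) Q :
  correlates a b Q -> correlates a (fun n => M *m b n) (Q *m M^T).
Proof.
by move=> /correlatesT/(correlatesMl M)/correlatesT; rewrite trmx_mul trmxK.
Qed.

Arguments correlatesMr {r s t} M {a b Q}.

Lemma correlatesDr r s (a : nat -> 'cV[R]_r) (b b' : nat -> 'cV[R]_s) Q Q' :
  correlates a b Q -> correlates a b' Q' ->
  correlates a (fun n => b n + b' n) (Q + Q').
Proof.
move=> /correlatesT h /correlatesT h'; have := correlatesT (correlatesDl h h').
by rewrite linearD/= !trmxK.
Qed.

Lemma correlatesNr r s (a : nat -> 'cV[R]_r) (b : nat -> 'cV[R]_s) Q :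
  correlates a b Q -> correlates a (fun n => - b n) (- Q).
Proof.
by move=> /correlatesT/correlatesNl/correlatesT; rewrite linearN/= trmxK.
Qed.

Lemma correlatesBr r s (a : nat -> 'cV[R]_r) (b b' : nat -> 'cV[R]_s) Q Q' :
  correlates a b Q -> correlates a b' Q' ->
  correlates a (fun n => b n - b' n) (Q - Q').
Proof. by move=> h /correlatesNr; exact: correlatesDr. Qed.

Definition tame_vec r (a : nat -> 'cV[R]_r) := tame (fun n => energy (a n)).
Definition bounded_vec r (a : nat -> 'cV[R]_r) := bounded_power (fun n => energy (a n)).

Lemma energy_trace r (a : nat -> 'cV[R]_r) N :
  average (fun n => energy (a n)) N = \tr (cross_average a a N).
Proof.
rewrite /mxtrace; under eq_bigr do rewrite cross_averageE.
rewrite /average -mulr_sumr; congr (_ * _).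
by rewrite exchange_big/=; apply: eq_bigr => n _; apply: eq_bigr => i _; rewrite expr2.
Qed.

Lemma energy_ge0 r (v : 'cV[R]_r) : 0 <= energy v.
Proof. by apply: sumr_ge0 => i _; exact: sqr_ge0. Qed.

Lemma correlates_tame r (a : nat -> 'cV[R]_r) Q : correlates a a Q -> tame_vec a.
Proof.
move=> h; apply: (@average_cvg_tame _ _ (\tr Q)) => [n|]; first exact: energy_ge0.
have := mcvg_trace h; apply: cvg_trans; apply: near_eq_cvg; apply: nearW => N.
by rewrite energy_trace.
Qed.

Lemma cauchy_schwarz_correlates r s (a : nat -> 'cV[R]_r) (b : nat -> 'cV[R]_s) :
  average (fun n => energy (a n)) N @[N --> \oo] --> 0 -> bounded_vec b ->
  correlates a b 0.
Proof.
move=> a0 [K bK] i j; rewrite mxE; apply: cvg0_sqr.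
have h : average (fun n => energy (a n)) N * K @[N --> \oo] --> 0.
  by rewrite -[X in _ --> X](mul0r K); apply: cvgM => //; exact: cvg_cst.
apply: (squeeze_cvgr _ (cvg_cst 0) h); near=> N.
have N0 : (0 < N)%N by near: N; exists 1%N.
rewrite sqr_ge0/= cross_averageE /average exprMn.
apply: (le_trans (ler_wpM2l (sqr_ge0 _) (cauchy_schwarz_sum _ _ _))).
have NV : 0 <= N%:R^-1 :> R by rewrite invr_ge0.
have le1 : \sum_(n < N) a n i 0 ^+ 2 <= \sum_(n < N) energy (a n).
  by apply: ler_sum => n _; rewrite /energy (bigD1 i)//= lerDl sumr_ge0// => k _; exact: sqr_ge0.
have le2 : \sum_(n < N) b n j 0 ^+ 2 <= K * N%:R.
  apply: le_trans (bK N); apply: ler_sum => n _.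
  by rewrite /energy (bigD1 j)//= lerDl sumr_ge0// => k _; exact: sqr_ge0.
apply: (@le_trans _ _ (N%:R^-1 ^+ 2 * ((\sum_(n < N) energy (a n)) * (K * N%:R)))).
  rewrite ler_wpM2l ?sqr_ge0//; apply: ler_pM => //; apply: sumr_ge0 => n _; exact: sqr_ge0.
rewrite le_eqVlt; apply/orP; left; apply/eqP; field.
by rewrite pnatr_eq0 -lt0n.
Unshelve. all: by end_near.
Qed.

(** The sums telescope to the last product minus the first, over [N]; products are bounded by
    energies, which are [o(N)]. *)
Lemma tame_shift r s (a : nat -> 'cV[R]_r) (b : nat -> 'cV[R]_s) :
  tame_vec a -> tame_vec b ->
  mcvg (fun N => cross_average (fun n => a n.+1) (fun n => b n.+1) N -
                 cross_average a b N) 0.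
Proof.
move=> [_ ta] [_ tb] i j; rewrite mxE.
pose f N := N%:R^-1 * (a N i 0 * b N j 0) - N%:R^-1 * (a 0 i 0 * b 0 j 0) : R.
have fE N : (cross_average (fun n => a n.+1) (fun n => b n.+1) N -
    cross_average a b N) i j = f N.
  rewrite mxE [X in _ + X]mxE !cross_averageE /average /f -!mulrBr; congr (_ * _).
  rewrite -sumrB; elim: N => [|N IH]; first by rewrite big_ord0 subrr.
  by rewrite big_ord_recr/= IH addrC subrKA.
suff : f N @[N --> \oo] --> (0 : R) by move=> f0; under eq_cvg do rewrite fE.
have V0 : N%:R^-1 @[N --> \oo] --> (0 : R).
  have h2 : 2 * N.+1%:R^-1 @[N --> \oo] --> (0 : R).
    rewrite -[X in _ --> X](mulr0 2); apply: cvgM; first exact: cvg_cst.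
    exact: cvg_harmonic.
  apply: (squeeze_cvgr _ (cvg_cst 0) h2); near=> N.
  have N0 : (0 < N)%N by near: N; exists 1%N.
  rewrite invr_ge0 ler0n/= mulrC ler_pdivlMl ?ltr0n// ler_pdivrMr ?ltr0n//.
  by rewrite -natrM ler_nat; lia.
rewrite -[X in _ --> X]subr0 -[X in _ --> _ - X](mul0r (a 0 i 0 * b 0 j 0)).
apply: cvgB; last by apply: cvgM => //; exact: cvg_cst.
apply/norm_cvg0P.
have h : 2 * (energy (a N) / N.+1%:R + energy (b N) / N.+1%:R) @[N --> \oo] --> 0.
  rewrite -[X in _ --> X](mulr0 2) -[X in _ * X](addr0 0).
  by apply: cvgM; [exact: cvg_cst|exact: cvgD].
apply: (squeeze_cvgr _ (cvg_cst 0) h); near=> N.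
have N0 : (0 < N)%N by near: N; exists 1%N.
rewrite normr_ge0/= normrM ger0_norm ?invr_ge0// -mulrDl.
have ea : a N i 0 ^+ 2 <= energy (a N).
  by rewrite /energy (bigD1 i)//= lerDl sumr_ge0// => k _; exact: sqr_ge0.
have eb : b N j 0 ^+ 2 <= energy (b N).
  by rewrite /energy (bigD1 j)//= lerDl sumr_ge0// => k _; exact: sqr_ge0.
have ab : `|a N i 0 * b N j 0| <= energy (a N) + energy (b N).
  rewrite normrM; have := sqr_ge0 (`|a N i 0| - `|b N j 0|).
  move: ea eb; rewrite -(real_normK (num_real (a N i 0))) -(real_normK (num_real (b N j 0))).
  by move: (normr_ge0 (a N i 0)) (normr_ge0 (b N j 0)); nra.
rewrite mulrC mulrA ler_pdivlMr ?ltr0n// mulrAC.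
rewrite ler_pdivrMr ?ltr0n//.
have N1 : N.+1%:R <= 2 * N%:R :> R by rewrite -natrM ler_nat; lia.
have Np : 0 <= N.+1%:R :> R by [].
have := ler_pM (normr_ge0 _) Np ab N1; by rewrite mulrCA mulrA.
Unshelve. all: by end_near.
Qed.

(** Expanding [a n.+1] and [b n.+1] in the shifted average expresses the average [S] through
    [F S G^T] and three known correlations. Hence [S - F S G^T] converges, and [S] tends to the only
    solution [X]. *)
Lemma stable_correlates r s (F : 'M[R]_r) (G : 'M[R]_s)
    (a f : nat -> 'cV[R]_r) (b g : nat -> 'cV[R]_s) Q1 Q2 Q3 X :
  schur_stable F -> schur_stable G ->
  (forall n, a n.+1 = F *m a n + f n) -> (forall n, b n.+1 = G *m b n + g n) ->
  tame_vec a -> tame_vec b ->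
  correlates a g Q1 -> correlates f b Q2 -> correlates f g Q3 ->
  X = F *m X *m G^T + (F *m Q1 + Q2 *m G^T + Q3) -> correlates a b X.
Proof.
move=> F1 G1 aE bE ta tb c1 c2 c3 XE.
apply: (lyapunov_cvg F1 G1).
have -> : X - F *m X *m G^T = F *m Q1 + Q2 *m G^T + Q3 - 0.
  by rewrite {1}XE addrC addKr subr0.
have c := mcvgD (mcvgD (mcvg_mulmxl F c1) (mcvg_mulmxr G^T c2)) c3.
apply: mcvg_eq (mcvgB c (tame_shift ta tb)) => N.
have -> : cross_average (fun n => a n.+1) (fun n => b n.+1) N =
    F *m cross_average a b N *m G^T + (F *m cross_average a g N +
    cross_average f b N *m G^T + cross_average f g N).
  rewrite /cross_average -!scalemxAr -!scalemxAl -!scalerDr; congr (_ *: _).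
  rewrite !mulmx_sumr !mulmx_suml -!big_split/=; apply: eq_bigr => n _.
  rewrite aE bE linearD/= trmx_mul mulmxDl !mulmxDr !mulmxA.
  by rewrite -!addrA.
set U := F *m cross_average a b N *m G^T; set W := (_ + _ + cross_average f g N).
by rewrite opprB addrCA opprD [W + _]addrCA subrr addr0.
Qed.

End matrix_limits.
Arguments mcvg_mulmxl {R r s t} M {S Q}.
Arguments correlatesMl {R r s t} M {a b Q}.
Arguments correlatesMr {R r s t} M {a b Q}.

(** * Vector signals: closure properties, shifts and delays *)

Section vector_signals.
Context (R : realType).

Lemma energy_vsqrc p (v : 'cV[R]_p) : energy v = vsqrc (map_mx (real_complex R) v).
Proof. by rewrite /vsqrc; apply: eq_bigr => i _; rewrite mxE sqrc_real. Qed.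

Section closure.
Variables (Q : (nat -> R) -> Prop).
Hypothesis QC : filter_class Q.

Lemma filter_class_vecD p (a b : nat -> 'cV[R]_p) :
  Q (fun n => energy (a n)) -> Q (fun n => energy (b n)) ->
  Q (fun n => energy (a n + b n)).
Proof.
move=> Qa Qb; apply: (filter_class_le QC (c := 2) _ _ (filter_classD QC Qa Qb)) => // n.
by rewrite energy_ge0 mulrDr !energy_vsqrc map_mxD vsqrcD_le.
Qed.

Lemma filter_class_vecM p m (M : 'M[R]_(m, p)) (a : nat -> 'cV[R]_p) :
  Q (fun n => energy (a n)) -> Q (fun n => energy (M *m a n)).
Proof.
have [c c0 cM] := vsqrc_mulmx_le (map_mx (real_complex R) M).
by apply: (filter_class_le QC c0) => n; rewrite energy_ge0 !energy_vsqrc map_mxM cM.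
Qed.

Lemma filter_class_vecN p (a : nat -> 'cV[R]_p) :
  Q (fun n => energy (a n)) -> Q (fun n => energy (- a n)).
Proof.
move=> Qa; have -> : (fun n => energy (- a n)) = (fun n => energy (- 1%:M *m a n)).
  by apply/funext => n; rewrite mulNmx mul1mx.
exact: filter_class_vecM.
Qed.

End closure.

Lemma tame_vecD p (a b : nat -> 'cV[R]_p) :
  tame_vec a -> tame_vec b -> tame_vec (fun n => a n + b n).
Proof. exact: (filter_class_vecD (tame_class R)). Qed.

Lemma tame_vecM p m (M : 'M[R]_(m, p)) (a : nat -> 'cV[R]_p) :
  tame_vec a -> tame_vec (fun n => M *m a n).
Proof. exact: (filter_class_vecM (tame_class R)). Qed.

Lemma tame_vecN p (a : nat -> 'cV[R]_p) : tame_vec a -> tame_vec (fun n => - a n).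
Proof. exact: (filter_class_vecN (tame_class R)). Qed.

Lemma tame_bounded p (a : nat -> 'cV[R]_p) : tame_vec a -> bounded_vec a.
Proof. by case. Qed.

Lemma sum_nat_shift (q : nat -> R) k N :
  \sum_(k <= n < N + k) q n = \sum_(n < N) q (n + k)%N.
Proof. by rewrite -{1}[k]add0n big_addn addnK big_mkord. Qed.

Lemma sum_shift_le (q : nat -> R) k N : (forall n, 0 <= q n) ->
  \sum_(n < N) q (n + k)%N <= \sum_(n < N + k) q n.
Proof.
move=> q0; rewrite -[leRHS](big_mkord xpredT) (@big_cat_nat _ _ _ k) ?leq_addl//=.
by rewrite sum_nat_shift lerDr sumr_ge0.
Qed.

Lemma bounded_vec_shift p (a : nat -> 'cV[R]_p) k :
  bounded_vec a -> bounded_vec (fun n => a (n + k)%N).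
Proof.
move=> [K hK]; have K0 : 0 <= K.
  have := hK 1; rewrite big_ord_recl big_ord0 addr0 mulr1; apply: le_trans.
  exact: energy_ge0.
exists (K * k.+1%:R) => -[|N]; first by rewrite big_ord0 mulr0.
apply: le_trans (@sum_shift_le (fun n => energy (a n)) k N.+1 _) _.
  by move=> n; exact: energy_ge0.
by rewrite (le_trans (hK _))// -mulrA ler_wpM2l// -natrM ler_nat; nia.
Qed.

Lemma average_shift0 (q : nat -> R) k : (forall n, 0 <= q n) ->
  average q N @[N --> \oo] --> 0 ->
  average (fun n => q (n + k)%N) N @[N --> \oo] --> 0.
Proof.
move=> q0 qv.
have h : k.+1%:R * average q (N + k)%N @[N --> \oo] --> 0.
  rewrite -[X in _ --> X](mulr0 k.+1%:R); apply: cvgM; first exact: cvg_cst.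
  apply: (cvg_comp _ _ _ qv); apply/cvgnyPge => A.
  by exists A => // n /= An; rewrite (leq_trans An)// leq_addr.
apply: (squeeze_cvgr _ (cvg_cst 0) h); near=> N.
have N0 : (0 < N)%N by near: N; exists 1%N.
rewrite mulr_ge0 ?invr_ge0 ?sumr_ge0//= /average mulrA.
apply: (@le_trans _ _ (N%:R^-1 * \sum_(n < N + k) q n)).
  by rewrite ler_wpM2l ?invr_ge0// sum_shift_le.
rewrite ler_wpM2r ?sumr_ge0// mulrC ler_pdivlMl ?ltr0n ?addn_gt0 ?N0//.
by rewrite ler_pdivrMr ?ltr0n// -natrM ler_nat; nia.
Unshelve. all: by end_near.
Qed.

Lemma cross_average_time_avg (T : Type) r s (a : nat -> T -> 'cV[R]_r)
    (b : nat -> T -> 'cV[R]_s) N t :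
  time_avg (fun n t => a n t *m (b n t)^T) N t =
  cross_average (a ^~ t) (b ^~ t) N.
Proof. by rewrite /time_avg /cross_average big_mkord. Qed.

Lemma cvg_mcvg r s (S : nat -> 'M[R]_(r, s)) Q : S @ \oo --> Q -> mcvg S Q.
Proof.
move=> SQ i j.
exact: (cvg_comp _ _ SQ (@coord_continuous _ _ _ i j Q)).
Qed.

Lemma mcvg_cvg r s (S : nat -> 'M[R]_(r, s)) Q : mcvg S Q -> S @ \oo --> Q.
Proof.
move=> SQ A [B BQ BA].
have h : \forall n \near \oo, forall i j, B i j (S n i j).
  by apply: filter_forall => i; apply: filter_forall => j; exact: SQ (BQ i j).
by apply: filterS h => n hn; apply: BA => i j; exact: hn.
Qed.

(** Reindexing: the first [k] delayed terms are 0 by convention, and normalizing by [N] instead of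
    [N + k] costs a factor at most [k + 1]. *)
Lemma correlates_delay r s (a : nat -> 'cV[R]_r) (b : nat -> 'cV[R]_s) k :
  correlates a (fun n => if (k <= n)%N then b (n - k)%N else 0) 0 ->
  correlates (fun n => a (n + k)%N) b 0.
Proof.
move=> h i j; rewrite mxE; apply/norm_cvg0P.
set c := fun n => _ in h.
have hk : `|k.+1%:R * cross_average a c (N + k)%N i j| @[N --> \oo] --> 0.
  apply/norm_cvg0P; rewrite -[X in _ --> X](mulr0 k.+1%:R).
  apply: cvgM; first exact: cvg_cst.
  have hij := h i j; rewrite mxE in hij.
  apply: (cvg_comp _ _ _ hij); apply/cvgnyPge => A.
  by exists A => // n /= An; rewrite (leq_trans An)// leq_addr.
apply: (squeeze_cvgr _ (cvg_cst 0) hk); near=> N.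
have N0 : (0 < N)%N by near: N; exists 1%N.
rewrite normr_ge0/=.
have cE : \sum_(n < N + k) a n i 0 * c n j 0 = \sum_(n < N) a (n + k)%N i 0 * b n j 0.
  rewrite -[LHS](big_mkord xpredT (fun n => a n i 0 * c n j 0)).
  rewrite (@big_cat_nat _ _ _ k) ?leq_addl//= big_nat big1 ?add0r; last first.
    by move=> n /andP[_ nk]; rewrite /c leqNgt nk/= mxE mulr0.
  rewrite (sum_nat_shift (fun n => a n i 0 * c n j 0)); apply: eq_bigr => n _.
  by rewrite /c leq_addl addnK.
rewrite !cross_averageE /average cE !normrM mulrA ler_wpM2r//.
rewrite !ger0_norm ?invr_ge0//.
rewrite mulrC ler_pdivlMl ?ltr0n ?addn_gt0 ?N0// ler_pdivrMr ?ltr0n//.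
by rewrite -natrM ler_nat; nia.
Unshelve. all: by end_near.
Qed.

Section uncorrelated.
Variables r s k : nat.
Implicit Types (a : nat -> 'cV[R]_r) (b : nat -> 'cV[R]_s).

Lemma uncorrelatedT a b : correlates a b 0 -> correlates b a 0.
Proof. by move=> /correlatesT; rewrite trmx0. Qed.

Lemma uncorrelatedMl (M : 'M[R]_(k, r)) a b :
  correlates a b 0 -> correlates (fun n => M *m a n) b 0.
Proof. by move=> /(correlatesMl M); rewrite mulmx0. Qed.

Lemma uncorrelatedDl a a' b : correlates a b 0 -> correlates a' b 0 ->
  correlates (fun n => a n + a' n) b 0.
Proof. by move=> h h'; have := correlatesDl h h'; rewrite addr0. Qed.

Lemma uncorrelatedNl a b : correlates a b 0 -> correlates (fun n => - a n) b 0.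
Proof. by move=> /correlatesNl; rewrite oppr0. Qed.

Lemma uncorrelatedMr (M : 'M[R]_(k, s)) a b :
  correlates a b 0 -> correlates a (fun n => M *m b n) 0.
Proof. by move=> /(correlatesMr M); rewrite mul0mx. Qed.

Lemma uncorrelatedDr a b b' : correlates a b 0 -> correlates a b' 0 ->
  correlates a (fun n => b n + b' n) 0.
Proof. by move=> h h'; have := correlatesDr h h'; rewrite addr0. Qed.

Lemma uncorrelatedNr a b : correlates a b 0 -> correlates a (fun n => - b n) 0.
Proof. by move=> /correlatesNr; rewrite oppr0. Qed.

End uncorrelated.

End vector_signals.

Section adapted_vectors.
Context (d : measure_display) (T : measurableType d) (R : realType)
  (H : set (set T)).

Lemma mx_adapted_cst r c (M : 'M[R]_(r, c)) : mx_adapted H (fun=> M).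
Proof. by move=> a b; exact: adapted_cst. Qed.

Lemma mx_adaptedD r c (X Y : T -> 'M[R]_(r, c)) :
  mx_adapted H X -> mx_adapted H Y -> mx_adapted H (fun t => X t + Y t).
Proof.
move=> aX aY a b; have := adaptedD (@aX a b) (@aY a b).
by congr adapted; apply/funext => t; rewrite mxE.
Qed.

Lemma mx_adaptedM r c k (M : 'M[R]_(k, r)) (X : T -> 'M[R]_(r, c)) :
  mx_adapted H X -> mx_adapted H (fun t => M *m X t).
Proof.
move=> aX a b.
have := @adapted_sum _ _ _ H _ (index_enum 'I_r) (fun j t => M a j * X t j b)
  (fun j => adaptedM (@adapted_cst _ _ _ H (M a j)) (@aX j b)).
by congr adapted; apply/funext => t; rewrite mxE.
Qed.

Lemma mx_adaptedZ r c (x : R) (X : T -> 'M[R]_(r, c)) :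
  mx_adapted H X -> mx_adapted H (fun t => x *: X t).
Proof.
move=> /(mx_adaptedM x%:M); congr mx_adapted; apply/funext => t.
by rewrite mul_scalar_mx.
Qed.

Lemma mx_adaptedN r c (X : T -> 'M[R]_(r, c)) :
  mx_adapted H X -> mx_adapted H (fun t => - X t).
Proof.
by move=> /(mx_adaptedZ (-1)); congr mx_adapted; apply/funext => t; rewrite scaleN1r.
Qed.

Lemma mx_adaptedB r c (X Y : T -> 'M[R]_(r, c)) :
  mx_adapted H X -> mx_adapted H Y -> mx_adapted H (fun t => X t - Y t).
Proof. by move=> aX /mx_adaptedN; exact: mx_adaptedD. Qed.

Lemma mx_adapted_recursion r (F : 'M[R]_r) (a f : nat -> T -> 'cV[R]_r) a0 n :
  (forall t, a 0 t = a0) -> (forall n t, a n.+1 t = F *m a n t + f n t) ->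
  (forall k, (k < n)%N -> mx_adapted H (f k)) -> mx_adapted H (a n).
Proof.
move=> a0E aS; elim: n => [_|n IH fa].
  have -> : a 0 = fun=> a0 by apply/funext.
  exact: mx_adapted_cst.
have -> : a n.+1 = fun t => F *m a n t + f n t by apply/funext.
apply: mx_adaptedD; last exact: fa.
by apply: mx_adaptedM; apply: IH => k kn; apply: fa; rewrite ltnW.
Qed.

End adapted_vectors.

Section noise_vectors.
Context (d : measure_display) (T : measurableType d) (R : realType)
  (P : probability T R) (I : finType) (G : I -> nat -> set (set T)).
Hypothesis Gsigma : forall i k, sigma_algebra setT (G i k).
Hypothesis Gmeas : forall i k, G i k `<=` measurable.
Hypothesis Gin : forall i, mutually_independent P (G i).
Hypothesis Gout : mutually_independent P
  (fun i => <<s \bigcup_(k in [set: nat]) G i k >>).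
Variables (i : I) (r : nat) (S : 'M[R]_r) (X : nat -> T -> 'cV[R]_r).
Hypothesis GX : forall k, G i k = sigma_vec (X k).
Hypothesis gX : forall k, centered_gaussian P S (X k).

Lemma noise_correlates : {ae P, forall t, correlates (X ^~ t) (X ^~ t) S}.
Proof.
have := noise_covariance_average Gsigma Gmeas Gin Gout GX gX 0.
apply: filterS => t h.
have : correlates (fun n => X (n + 0)%N t) (fun n => X (n + 0)%N t) S.
  by move=> a b; under eq_cvg do rewrite cross_averageE; exact: h.
by apply: correlates_eq => n; rewrite addn0.
Qed.

Lemma predictable_correlates l c (V : nat -> T -> 'cV[R]_c) :
  (forall n, mx_adapted (others G i (n + l)%N) (V n)) ->
  {ae P, forall t, bounded_vec (V ^~ t) ->
    correlates (V ^~ t) (fun n => X (n + l)%N t) 0}.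
Proof.
move=> aV.
apply: filterS (noise_predictable_average Gsigma Gmeas Gin Gout GX gX aV) => t h K a b.
rewrite mxE; under eq_cvg do rewrite cross_averageE.
exact: h.
Qed.

Lemma predictable_correlates0 c (V : nat -> T -> 'cV[R]_c) :
  (forall n, mx_adapted (others G i n) (V n)) ->
  {ae P, forall t, bounded_vec (V ^~ t) -> correlates (V ^~ t) (X ^~ t) 0}.
Proof.
move=> aV; have := @predictable_correlates 0 c V.
have aV0 n : mx_adapted (others G i (n + 0)%N) (V n) by rewrite addn0.
move=> /(_ aV0); apply: filterS => t h K; apply: correlates_eq (h K) => // n.
by rewrite addn0.
Qed.

End noise_vectors.

(** * The attacked loop *)

Fixpoint recursion (R : realType) p (F : 'M[R]_p) (a0 : 'cV[R]_p)
    (f : nat -> 'cV[R]_p) n : 'cV[R]_p :=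
  if n is k.+1 then F *m recursion F a0 f k + f k else a0.

Section attacked_loop.
Context (R : realType) (d : measure_display) (T : measurableType d)
  (P : probability T R) (p q m : nat).
Variables (A : 'M[R]_p) (B : 'M[R]_(p, q)) (C : 'M[R]_(m, p))
  (K : 'M[R]_(q, p)) (L : 'M[R]_(p, m))
  (SigmaW : 'M[R]_p) (SigmaZ : 'M[R]_m) (SigmaE : 'M[R]_q)
  (SigmaS : 'M[R]_m) (SigmaO : 'M[R]_p) (SigmaD : 'M[R]_p)
  (alpha : R) (x0 xh0 xi0 : 'cV[R]_p)
  (w : nat -> T -> 'cV[R]_p) (z : nat -> T -> 'cV[R]_m)
  (e : nat -> T -> 'cV[R]_q)
  (zeta : nat -> T -> 'cV[R]_m) (omega : nat -> T -> 'cV[R]_p)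
  (x xh xi : nat -> T -> 'cV[R]_p) (u : nat -> T -> 'cV[R]_q)
  (y v : nat -> T -> 'cV[R]_m) (k' : nat).
Hypotheses (hw : iid_centered_gaussian P SigmaW w)
  (hz : iid_centered_gaussian P SigmaZ z)
  (he : iid_centered_gaussian P SigmaE e)
  (hzeta : iid_centered_gaussian P SigmaS zeta)
  (homega : iid_centered_gaussian P SigmaO omega)
  (hindep : mutually_independent P
     (tnth [tuple sigma_process w; sigma_process z; sigma_process e;
                  sigma_process zeta; sigma_process omega]))
  (hx0 : forall t, x 0%N t = x0)
  (hx : forall n t, x n.+1 t = A *m x n t + B *m u n t + w n t)
  (hy : forall n t, y n t = C *m x n t + z n t + v n t)
  (hu : forall n t, u n t = K *m xh n t + e n t)
  (hxh0 : forall t, xh 0%N t = xh0)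
  (hxh : forall n t, xh n.+1 t =
     (A + B *m K + L *m C) *m xh n t + B *m e n t - L *m y n t)
  (hxi0 : forall t, xi 0%N t = xi0)
  (hxi : forall n t, xi n.+1 t = (A + B *m K) *m xi n t + omega n t)
  (hv : forall n t, v n t =
     alpha *: (C *m x n t + z n t) + C *m xi n t + zeta n t).

Let G : 'I_5 -> nat -> set (set T) := tnth
  [tuple (fun k => sigma_vec (w k)); (fun k => sigma_vec (z k));
         (fun k => sigma_vec (e k)); (fun k => sigma_vec (zeta k));
         (fun k => sigma_vec (omega k))].
Let iw : 'I_5 := @Ordinal 5 0 isT.
Let iz : 'I_5 := @Ordinal 5 1 isT.
Let ie : 'I_5 := @Ordinal 5 2 isT.
Let izeta : 'I_5 := @Ordinal 5 3 isT.
Let iomega : 'I_5 := @Ordinal 5 4 isT.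

Let sigma_vec_sub n r (S : 'M[R]_r) (X : nat -> T -> 'cV[R]_r) :
  iid_centered_gaussian P S X -> sigma_vec (X n) `<=` measurable.
Proof.
move=> [gX _]; apply: smallest_sub; first exact: sigma_algebra_measurable.
move=> U [i _ [V mV <-]].
by have [[mX _] _ _] := gX n; exact: (mX i measurableT V mV).
Qed.

Let Gsigma i k : sigma_algebra setT (G i k).
Proof.
by case: i => -[|[|[|[|[|//]]]]] ?; exact: smallest_sigma_algebra.
Qed.

Let Gmeas i k : G i k `<=` measurable.
Proof.
by case: i => -[|[|[|[|[|//]]]]] ?; [exact: sigma_vec_sub hw|
  exact: sigma_vec_sub hz|exact: sigma_vec_sub he|exact: sigma_vec_sub hzeta|
  exact: sigma_vec_sub homega].
Qed.

Let Gin i : mutually_independent P (G i).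
Proof.
by case: i => -[|[|[|[|[|//]]]]] ?; [case: hw|case: hz|case: he|case: hzeta|case: homega].
Qed.

Let Gout : mutually_independent P (fun i => <<s \bigcup_(k in [set: nat]) G i k >>).
Proof.
rewrite (_ : (fun i => _) = tnth [tuple sigma_process w; sigma_process z;
  sigma_process e; sigma_process zeta; sigma_process omega])//.
by apply/funext => -[[|[|[|[|[|//]]]]] ?].
Qed.

Let Gw n i l : iw != i \/ (n < l)%N -> mx_adapted (others G i l) (w n).
Proof. by move=> h; apply: (mx_adapted_others h); exact: sigma_vec_adapted. Qed.
Let Gz n i l : iz != i \/ (n < l)%N -> mx_adapted (others G i l) (z n).
Proof. by move=> h; apply: (mx_adapted_others h); exact: sigma_vec_adapted. Qed.
Let Ge n i l : ie != i \/ (n < l)%N -> mx_adapted (others G i l) (e n).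
Proof. by move=> h; apply: (mx_adapted_others h); exact: sigma_vec_adapted. Qed.
Let Gzeta n i l : izeta != i \/ (n < l)%N -> mx_adapted (others G i l) (zeta n).
Proof. by move=> h; apply: (mx_adapted_others h); exact: sigma_vec_adapted. Qed.
Let Gomega n i l : iomega != i \/ (n < l)%N -> mx_adapted (others G i l) (omega n).
Proof. by move=> h; apply: (mx_adapted_others h); exact: sigma_vec_adapted. Qed.

Let M := A + B *m K.
Let r n t := C *m xh n t - y n t.

(** Only [omega] before time [n] drives [xi n], so the time restriction concerns that source
    alone. *)
Let xi_adapted i n l : (iomega != i) || (n <= l)%N -> mx_adapted (others G i l) (xi n).
Proof.
move=> h; apply: (mx_adapted_recursion hxi0 hxi) => k kn; apply: Gomega.
by case/orP: h => h; [left|right; exact: leq_trans kn h].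
Qed.

Let y_adapted H n (E : T -> 'cV[R]_p) : mx_adapted H (fun t => x n t - E t) ->
  (forall t, C *m E t = 0) -> mx_adapted H (z n) -> mx_adapted H (xi n) ->
  mx_adapted H (zeta n) -> mx_adapted H (y n).
Proof.
move=> ax CE az axi azeta.
have -> : y n = fun t => (C *m (x n t - E t) + z n t) +
    (alpha *: (C *m (x n t - E t) + z n t) + C *m xi n t + zeta n t).
  by apply/funext => t; rewrite hy hv mulmxBr CE subr0.
have aCz : mx_adapted H (fun t => C *m (x n t - E t) + z n t).
  by apply: mx_adaptedD => //; exact: mx_adaptedM.
apply: mx_adaptedD => //; apply: mx_adaptedD => //.
by apply: mx_adaptedD; [exact: mx_adaptedZ|exact: mx_adaptedM].
Qed.

(* One step of plant and observer, with the same shift [E] removed from both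
   states and an unobservable one ([C E = 0]) not fed back by the output. *)
Let step_adapted H n (E E' : T -> 'cV[R]_p) (f : T -> 'cV[R]_q) :
  mx_adapted H (fun t => x n t - E t) -> mx_adapted H (fun t => xh n t - E t) ->
  (forall t, C *m E t = 0) ->
  (forall t, E' t = M *m E t + B *m f t) -> mx_adapted H (fun t => e n t - f t) ->
  mx_adapted H (w n) -> mx_adapted H (z n) -> mx_adapted H (xi n) ->
  mx_adapted H (zeta n) ->
  mx_adapted H (fun t => x n.+1 t - E' t) /\ mx_adapted H (fun t => xh n.+1 t - E' t).
Proof.
move=> ax axh CE E'E ae aw az axi azeta.
have ay : mx_adapted H (y n) by exact: y_adapted ax CE az axi azeta.
split.
  have -> : (fun t => x n.+1 t - E' t) = fun t => A *m (x n t - E t) +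
      B *m (K *m (xh n t - E t) + (e n t - f t)) + w n t.
    apply/funext => t; rewrite hx hu E'E /M.
    rewrite !(mulmxDl, mulmxDr, mulmxBl, mulmxBr, mulmxN, mulmxA).
    by apply/matrixP => i j; rewrite !mxE; ring.
  do 2 (apply: mx_adaptedD => //); first exact: mx_adaptedM.
  by apply: mx_adaptedM; apply: mx_adaptedD => //; exact: mx_adaptedM.
have -> : (fun t => xh n.+1 t - E' t) = fun t => (A + B *m K + L *m C) *m (xh n t - E t) +
    B *m (e n t - f t) - L *m y n t.
  apply/funext => t; rewrite hxh E'E /M.
  have LCE : L *m C *m E t = 0 by rewrite -mulmxA CE mulmx0.
  rewrite !(mulmxDl, mulmxDr, mulmxBl, mulmxBr, mulmxN) LCE.
  by apply/matrixP => i j; rewrite !mxE; ring.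
apply: mx_adaptedB; last exact: mx_adaptedM.
by apply: mx_adaptedD; exact: mx_adaptedM.
Qed.

Let state_adapted n : mx_adapted (others G ie n) (x n) /\ mx_adapted (others G ie n) (xh n).
Proof.
suff : forall l, (l <= n)%N ->
    mx_adapted (others G ie n) (x l) /\ mx_adapted (others G ie n) (xh l).
  exact.
elim=> [_|l IH ln].
  have -> : x 0 = fun=> x0 by apply/funext.
  have -> : xh 0 = fun=> xh0 by apply/funext.
  by split; exact: mx_adapted_cst.
have [ax axh] := IH (ltnW ln).
have sub0E r' (X : T -> 'cV[R]_r') : (fun t => X t - 0) = X by apply/funext => t; rewrite subr0.
have := @step_adapted (others G ie n) l (fun=> 0) (fun=> 0) (fun=> 0).
rewrite !sub0E; apply => //.
- by move=> t; rewrite mulmx0.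
- by move=> t; rewrite !mulmx0 addr0.
- by apply: Ge; right.
- by apply: Gw; left.
- by apply: Gz; left.
- by apply: xi_adapted.
- by apply: Gzeta; left.
Qed.

(** * The watermark test: how one excitation value reaches the residual *)

Hypothesis hk'_min : forall k : nat, C *m M ^+ k *m B <> 0 -> (k' <= k)%N.

Let markov0 k : (k < k')%N -> C *m M ^+ k *m B = 0.
Proof. by move=> kk; apply: contrapT => /hk'_min; rewrite leqNgt kk. Qed.

(** The family omits every watermark from time [n] on, so [E] has to collect [e n] together with the
    later ones. Plant and observer carry the same [E], hence [C xh] receives [C E] while [y]
    receives [(1 + alpha) C E], and [- alpha C E] remains in the residual. *)
Let residual_adapted n :
  mx_adapted (others G ie n)
    (fun t => r (n + k'.+1)%N t + alpha *: (C *m M ^+ k' *m B *m e n t)).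
Proof.
pose H := others G ie n.
(* The invariant covers all powers [a] up to [k' - l]: each step uses one of them, and the later
   watermarks enter through Markov parameters that are still zero. *)
have main l : (l <= k')%N -> exists E : T -> 'cV[R]_p,
  [/\ mx_adapted H (fun t => x (n + l.+1)%N t - E t),
      mx_adapted H (fun t => xh (n + l.+1)%N t - E t) &
      forall a t, (a + l <= k')%N -> C *m M ^+ a *m E t = C *m M ^+ (a + l) *m B *m e n t].
  elim: l => [_|l IH lk].
    exists (fun t => B *m e n t); rewrite addn1; have [ax axh] := state_adapted n.
    have sub0E r' (X : T -> 'cV[R]_r') : (fun t => X t - 0) = X.
      by apply/funext => t; rewrite subr0.
    have := @step_adapted H n (fun=> 0) (fun t => B *m e n t) (e n).
    rewrite !sub0E => h; have [] := h ax axh.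
    - by move=> t; rewrite mulmx0.
    - by move=> t; rewrite mulmx0 add0r.
    - rewrite (_ : (fun t => _) = fun=> 0); first exact: mx_adapted_cst.
      by apply/funext => t; rewrite subrr.
    - by apply: Gw; left.
    - by apply: Gz; left.
    - by apply: xi_adapted.
    - by apply: Gzeta; left.
    by move=> ax' axh'; split=> // a t _; rewrite addn0 mulmxA.
  have [E [ax axh CE]] := IH (ltnW lk).
  exists (fun t => M *m E t + B *m e (n + l.+1)%N t); rewrite addnS.
  have [] := @step_adapted H (n + l.+1)%N E
    (fun t => M *m E t + B *m e (n + l.+1)%N t) (e (n + l.+1)%N) ax axh.
  - move=> t; have := CE 0 t (ltnW lk); rewrite expr0 mulmx1 add0n => ->.
    by rewrite markov0// mul0mx.
  - by [].
  - rewrite (_ : (fun t => _) = fun=> 0); first exact: mx_adapted_cst.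
    by apply/funext => t; rewrite subrr.
  - by apply: Gw; left.
  - by apply: Gz; left.
  - by apply: xi_adapted.
  - by apply: Gzeta; left.
  move=> ax' axh'; split=> // a t ak.
  rewrite mulmxDr !mulmxA [C *m M ^+ a *m B]markov0; last first.
    by rewrite (leq_trans _ ak)// addnS ltnS leq_addr.
  rewrite mul0mx addr0 -(mulmxA C) mulmxE -exprSr CE ?addSnnS//.
have [E [ax axh CE]] := main k' (leqnn _).
have CEt t : C *m E t = C *m M ^+ k' *m B *m e n t.
  by have := CE 0 t (leqnn _); rewrite expr0 mulmx1 add0n.
pose c t := C *m (x (n + k'.+1)%N t - E t) + z (n + k'.+1)%N t.
have -> : (fun t => r (n + k'.+1)%N t + alpha *: (C *m M ^+ k' *m B *m e n t)) =
   fun t => C *m (xh (n + k'.+1)%N t - E t) - (c t + (alpha *: c t +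
     C *m xi (n + k'.+1)%N t + zeta (n + k'.+1)%N t)).
  apply/funext => t; rewrite /r /c hy hv -CEt !mulmxBr.
  by apply/matrixP => i j; rewrite !mxE; ring.
have ac : mx_adapted H c.
  by apply: mx_adaptedD; [exact: mx_adaptedM|apply: Gz; left].
apply: mx_adaptedB; first exact: mx_adaptedM.
apply: mx_adaptedD => //; apply: mx_adaptedD; last by apply: Gzeta; left.
apply: mx_adaptedD; first exact: mx_adaptedZ.
by apply: mx_adaptedM; exact: xi_adapted.
Qed.

Let Tw c (V : nat -> T -> 'cV[R]_c) :=
  @predictable_correlates0 _ _ _ _ _ _ Gsigma Gmeas Gin Gout
    iw _ _ w (fun=> erefl) hw.1 c V.
Let Tz c (V : nat -> T -> 'cV[R]_c) :=
  @predictable_correlates0 _ _ _ _ _ _ Gsigma Gmeas Gin Gout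
    iz _ _ z (fun=> erefl) hz.1 c V.
Let Te c (V : nat -> T -> 'cV[R]_c) :=
  @predictable_correlates0 _ _ _ _ _ _ Gsigma Gmeas Gin Gout
    ie _ _ e (fun=> erefl) he.1 c V.
Let Tzeta c (V : nat -> T -> 'cV[R]_c) :=
  @predictable_correlates0 _ _ _ _ _ _ Gsigma Gmeas Gin Gout
    izeta _ _ zeta (fun=> erefl) hzeta.1 c V.
Let Tomega c (V : nat -> T -> 'cV[R]_c) :=
  @predictable_correlates0 _ _ _ _ _ _ Gsigma Gmeas Gin Gout
    iomega _ _ omega (fun=> erefl) homega.1 c V.
Let cov_w : {ae P, forall t, correlates (w ^~ t) (w ^~ t) SigmaW}.
Proof. exact: (noise_correlates Gsigma Gmeas Gin Gout (i := iw) (fun=> erefl) hw.1). Qed.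
Let cov_z : {ae P, forall t, correlates (z ^~ t) (z ^~ t) SigmaZ}.
Proof. exact: (noise_correlates Gsigma Gmeas Gin Gout (i := iz) (fun=> erefl) hz.1). Qed.
Let cov_e : {ae P, forall t, correlates (e ^~ t) (e ^~ t) SigmaE}.
Proof. exact: (noise_correlates Gsigma Gmeas Gin Gout (i := ie) (fun=> erefl) he.1). Qed.
Let cov_zeta : {ae P, forall t, correlates (zeta ^~ t) (zeta ^~ t) SigmaS}.
Proof. exact: (noise_correlates Gsigma Gmeas Gin Gout (i := izeta) (fun=> erefl) hzeta.1). Qed.
Let cov_omega : {ae P, forall t, correlates (omega ^~ t) (omega ^~ t) SigmaO}.
Proof. exact: (noise_correlates Gsigma Gmeas Gin Gout (i := iomega) (fun=> erefl) homega.1). Qed.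

Lemma watermark_gain_eq0 (Sigma : 'M[R]_m) :
  \rank SigmaE = q -> C *m M ^+ k' *m B <> 0 ->
  {ae P, forall t, correlates (r ^~ t) (r ^~ t) Sigma ->
    correlates (r ^~ t) (fun n => delay k'.+1 e n t) 0 -> alpha = 0}.
Proof.
move=> rankE hk'; near=> t => rr re.
pose N := C *m M ^+ k' *m B.
have ee : correlates (e ^~ t) (e ^~ t) SigmaE by near: t; exact: cov_e.
pose V n t := r (n + k'.+1)%N t + alpha *: (N *m e n t).
have Ve : bounded_vec (V ^~ t) -> correlates (V ^~ t) (e ^~ t) 0.
  by near: t; apply: Te; exact: residual_adapted.
have re' := @correlates_delay _ _ _ (r ^~ t) (e ^~ t) k'.+1 re.
have NE n : alpha *: (N *m e n t) = (alpha *: N) *m e n t by rewrite scalemxAl.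
have {}Ve : correlates (V ^~ t) (e ^~ t) 0.
  apply: Ve; apply: (filter_class_vecD (bounded_power_class R)).
    exact/(@bounded_vec_shift _ _ (r ^~ t))/tame_bounded/(correlates_tame rr).
  have := filter_class_vecM (bounded_power_class R) (alpha *: N)
    (tame_bounded (correlates_tame ee)).
  by congr bounded_power; apply/funext => n; rewrite NE.
(* The signal is [V] minus the shifted residual: the first is uncorrelated with [e] by
   predictability, the second by the delayed test. *)
have c1 : correlates (fun n => (alpha *: N) *m e n t) (e ^~ t) (0 - 0).
  apply: (@correlates_eq _ _ _ (fun n => V n t - r (n + k'.+1)%N t) _ (e ^~ t)) => //.
    by move=> n; rewrite /V addrC addKr NE.
  by apply: correlatesBl; [exact: Ve|exact: re'].
have c2 : correlates (fun n => (alpha *: N) *m e n t) (e ^~ t) ((alpha *: N) *m SigmaE).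
  by apply: correlatesMl; exact: ee.
have := mcvg_unique c1 c2; rewrite subr0.
have uE : SigmaE \in unitmx by rewrite -row_free_unit /row_free rankE.
move/esym => /(congr1 (mulmx^~ (invmx SigmaE))); rewrite mulmxK// mul0mx.
move/eqP; rewrite scaler_eq0 => /orP[/eqP//|/eqP N0].
by case: hk'.
Unshelve. all: by end_near.
Qed.

(** * The loop with [alpha = 0]: the attack has zero power *)

Let F := A + L *m C.
Let d1 n t := recursion F (xh0 - x0) (fun k => - (w k t + L *m z k t)) n.
Let d2 n t := recursion F 0 (fun k => - (L *m v k t)) n.

Hypothesis alpha0 : alpha = 0.

Let vE n t : v n t = C *m xi n t + zeta n t.
Proof. by rewrite hv alpha0 scale0r add0r. Qed.

Let rE n t : r n t = (C *m d1 n t - z n t) + (C *m d2 n t - v n t).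
Proof.
have dE : xh n t - x n t = d1 n t + d2 n t.
  elim: n => [|n IH]; first by rewrite hx0 hxh0 /d1 /d2/= addr0.
  have -> : xh n.+1 t - x n.+1 t = F *m (xh n t - x n t) - (w n t + L *m z n t) - L *m v n t.
    rewrite hx hxh hu hy /F.
    rewrite !(mulmxDl, mulmxDr, mulmxBl, mulmxBr, mulmxN, mulmxA).
    by apply/matrixP => i j; rewrite !mxE; ring.
  by rewrite IH /d1 /d2/= mulmxDr; apply/matrixP => i j; rewrite !mxE; ring.
rewrite /r hy.
rewrite (_ : C *m xh n t = C *m x n t + (C *m d1 n t + C *m d2 n t)).
  by apply/matrixP => i j; rewrite !mxE; ring.
by rewrite -mulmxDr -dE mulmxBr addrC subrK.
Qed.

(** Only noise strictly before [n] drives [d1 n], so it is predictable for every source at once;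
    likewise [d2 n] and [xi n]. *)
Let d1_adapted i n : mx_adapted (others G i n) (d1 n).
Proof.
apply: (@mx_adapted_recursion _ _ _ _ _ F d1
  (fun k t => - (w k t + L *m z k t)) (xh0 - x0)) => // k kn.
apply: mx_adaptedN; apply: mx_adaptedD; first by apply: Gw; right.
by apply: mx_adaptedM; apply: Gz; right.
Qed.

Let v_adapted i k n : (k < n)%N -> mx_adapted (others G i n) (v k).
Proof.
move=> kn; have -> : v k = fun t => C *m xi k t + zeta k t by apply/funext => t; rewrite vE.
apply: mx_adaptedD; last by apply: Gzeta; right.
by apply: mx_adaptedM; apply: xi_adapted; rewrite (ltnW kn) orbT.
Qed.

Let d2_adapted i n : mx_adapted (others G i n) (d2 n).
Proof.
apply: (@mx_adapted_recursion _ _ _ _ _ F d2 (fun k t => - (L *m v k t)) 0) => // k kn.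
by apply: mx_adaptedN; apply: mx_adaptedM; exact: v_adapted.
Qed.

Let xi_adapted' i n : mx_adapted (others G i n) (xi n).
Proof. by apply: xi_adapted; rewrite leqnn orbT. Qed.

Hypotheses (hK : schur_stable M) (hL : schur_stable F).
Hypothesis hSigmaD : SigmaD = F *m SigmaD *m F^T + SigmaW + L *m SigmaZ *m L^T.

Lemma stealthy_attack_power0 : {ae P, forall t,
  correlates (r ^~ t) (r ^~ t) (C *m SigmaD *m C^T + SigmaZ) ->
  average (fun n => energy (v n t)) N @[N --> \oo] --> 0}.
Proof.
near=> t => rr.
have ww : correlates (w ^~ t) (w ^~ t) SigmaW by near: t; exact: cov_w.
have zz : correlates (z ^~ t) (z ^~ t) SigmaZ by near: t; exact: cov_z.
have ss : correlates (zeta ^~ t) (zeta ^~ t) SigmaS by near: t; exact: cov_zeta.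
have oo : correlates (omega ^~ t) (omega ^~ t) SigmaO by near: t; exact: cov_omega.
have tw := correlates_tame ww; have tz := correlates_tame zz.
have ts := correlates_tame ss; have tom := correlates_tame oo.
pose f n := - (w n t + L *m z n t).
have tf : tame_vec f by apply: tame_vecN; apply: tame_vecD => //; exact: tame_vecM.
have td1 : tame_vec (d1 ^~ t).
  exact: (stable_filter (tame_class R) hL (f := f)).
have txi : tame_vec (xi ^~ t).
  exact: (stable_filter (tame_class R) hK (hxi ^~ t)).
have tv : tame_vec (v ^~ t).
  have -> : v ^~ t = fun n => C *m xi n t + zeta n t by apply/funext => n; rewrite vE.
  by apply: tame_vecD => //; exact: tame_vecM.
have td2 : tame_vec (d2 ^~ t).
  apply: (stable_filter (tame_class R) hL (f := fun n => - (L *m v n t))) => //.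
  by apply: tame_vecN; exact: tame_vecM.
have d1w : bounded_vec (d1 ^~ t) -> correlates (d1 ^~ t) (w ^~ t) 0.
  by near: t; apply: Tw => n; exact: d1_adapted.
have {}d1w := d1w (tame_bounded td1).
have d1z : bounded_vec (d1 ^~ t) -> correlates (d1 ^~ t) (z ^~ t) 0.
  by near: t; apply: Tz => n; exact: d1_adapted.
have {}d1z := d1z (tame_bounded td1).
have d1s : bounded_vec (d1 ^~ t) -> correlates (d1 ^~ t) (zeta ^~ t) 0.
  by near: t; apply: Tzeta => n; exact: d1_adapted.
have {}d1s := d1s (tame_bounded td1).
have d1o : bounded_vec (d1 ^~ t) -> correlates (d1 ^~ t) (omega ^~ t) 0.
  by near: t; apply: Tomega => n; exact: d1_adapted.
have {}d1o := d1o (tame_bounded td1).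
have xiw : bounded_vec (xi ^~ t) -> correlates (xi ^~ t) (w ^~ t) 0.
  by near: t; apply: Tw => n; exact: xi_adapted'.
have {}xiw := xiw (tame_bounded txi).
have xiz : bounded_vec (xi ^~ t) -> correlates (xi ^~ t) (z ^~ t) 0.
  by near: t; apply: Tz => n; exact: xi_adapted'.
have {}xiz := xiz (tame_bounded txi).
have xis : bounded_vec (xi ^~ t) -> correlates (xi ^~ t) (zeta ^~ t) 0.
  by near: t; apply: Tzeta => n; exact: xi_adapted'.
have {}xis := xis (tame_bounded txi).
have xio : bounded_vec (xi ^~ t) -> correlates (xi ^~ t) (omega ^~ t) 0.
  by near: t; apply: Tomega => n; exact: xi_adapted'.
have {}xio := xio (tame_bounded txi).
have d2w : bounded_vec (d2 ^~ t) -> correlates (d2 ^~ t) (w ^~ t) 0.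
  by near: t; apply: Tw => n; exact: d2_adapted.
have {}d2w := d2w (tame_bounded td2).
have d2z : bounded_vec (d2 ^~ t) -> correlates (d2 ^~ t) (z ^~ t) 0.
  by near: t; apply: Tz => n; exact: d2_adapted.
have {}d2z := d2z (tame_bounded td2).
have d2s : bounded_vec (d2 ^~ t) -> correlates (d2 ^~ t) (zeta ^~ t) 0.
  by near: t; apply: Tzeta => n; exact: d2_adapted.
have {}d2s := d2s (tame_bounded td2).
have d2o : bounded_vec (d2 ^~ t) -> correlates (d2 ^~ t) (omega ^~ t) 0.
  by near: t; apply: Tomega => n; exact: d2_adapted.
have {}d2o := d2o (tame_bounded td2).
have wz : bounded_vec (w ^~ t) -> correlates (w ^~ t) (z ^~ t) 0.
  by near: t; apply: Tz => n; apply: Gw; left.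
have {}wz := wz (tame_bounded tw).
have ws : bounded_vec (w ^~ t) -> correlates (w ^~ t) (zeta ^~ t) 0.
  by near: t; apply: Tzeta => n; apply: Gw; left.
have {}ws := ws (tame_bounded tw).
have wo : bounded_vec (w ^~ t) -> correlates (w ^~ t) (omega ^~ t) 0.
  by near: t; apply: Tomega => n; apply: Gw; left.
have {}wo := wo (tame_bounded tw).
have zs : bounded_vec (z ^~ t) -> correlates (z ^~ t) (zeta ^~ t) 0.
  by near: t; apply: Tzeta => n; apply: Gz; left.
have {}zs := zs (tame_bounded tz).
have zo : bounded_vec (z ^~ t) -> correlates (z ^~ t) (omega ^~ t) 0.
  by near: t; apply: Tomega => n; apply: Gz; left.
have {}zo := zo (tame_bounded tz).
(* All lags are needed on the same path; they are countably many. *)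
have so : forall k, bounded_vec (fun n => zeta (n + k)%N t) ->
    correlates (fun n => zeta (n + k)%N t) (omega ^~ t) 0.
  near: t; apply: ae_foralln => k.
  by apply: (@Tomega _ (fun n => zeta (n + k)%N)) => n; apply: Gzeta; left.
have {}so k := so k (bounded_vec_shift k (tame_bounded ts)).
have ook : forall k, bounded_vec (omega ^~ t) ->
    correlates (omega ^~ t) (fun n => omega (n + k.+1)%N t) 0.
  near: t; apply: ae_foralln => k.
  apply: (predictable_correlates Gsigma Gmeas Gin Gout (i := iomega) (fun=> erefl) homega.1) => n.
  by apply: Gomega; right; rewrite addnS ltnS leq_addr.
have {}ook k := ook k (tame_bounded tom).
have vr a (b : nat -> 'cV[R]_a) : correlates b (xi ^~ t) 0 -> correlates b (zeta ^~ t) 0 ->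
    correlates b (v ^~ t) 0.
  move=> bx bs; apply: (@correlates_eq _ _ _ b _ (fun n => C *m xi n t + zeta n t)) => //.
  by apply: uncorrelatedDr => //; exact: uncorrelatedMr.
have fl a (b : nat -> 'cV[R]_a) : correlates (w ^~ t) b 0 -> correlates (z ^~ t) b 0 ->
    correlates f b 0.
  by move=> wb zb; apply: uncorrelatedNl; apply: uncorrelatedDl => //; exact: uncorrelatedMl.
have ff : correlates f f (SigmaW + L *m SigmaZ *m L^T).
  have wf : correlates (w ^~ t) f (- (SigmaW + 0 *m L^T)).
    by apply: correlatesNr; apply: correlatesDr => //; exact: correlatesMr.
  have zf : correlates (z ^~ t) f (- (0 + SigmaZ *m L^T)).
    apply: correlatesNr; apply: correlatesDr; last exact: correlatesMr.
    exact: uncorrelatedT.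
  have := correlatesNl (correlatesDl wf (correlatesMl L zf)).
  by rewrite mul0mx addr0 add0r mulmxN opprD !opprK mulmxA.
have d1f : correlates (d1 ^~ t) f 0.
  by apply: uncorrelatedT; apply: fl; exact: uncorrelatedT.
(* [SigmaD] solves the equation obeyed by the limiting covariance of [d1], and that equation has
   only one solution. *)
have d1d1 : correlates (d1 ^~ t) (d1 ^~ t) SigmaD.
  apply: (stable_correlates hL hL (fun=> erefl) (fun=> erefl) td1 td1 d1f
    (uncorrelatedT d1f) ff).
  by rewrite mulmx0 mul0mx !add0r addrA.
have d1xi : correlates (d1 ^~ t) (xi ^~ t) 0.
  apply: (stable_correlates hL hK (fun=> erefl) (hxi ^~ t) td1 txi d1o
    (fl _ _ (uncorrelatedT xiw) (uncorrelatedT xiz)) (fl _ _ wo zo)).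
  by rewrite !(mulmx0, mul0mx) !addr0.
have d1v := vr _ _ d1xi d1s.
have Lvr a (b : nat -> 'cV[R]_a) : correlates b (v ^~ t) 0 ->
    correlates b (fun n => - (L *m v n t)) 0.
  by move=> bv; apply: uncorrelatedNr; exact: uncorrelatedMr.
have wv := vr _ _ (uncorrelatedT xiw) ws.
have zv := vr _ _ (uncorrelatedT xiz) zs.
have d1d2 : correlates (d1 ^~ t) (d2 ^~ t) 0.
  apply: (stable_correlates hL hL (fun=> erefl) (fun=> erefl) td1 td2 (Lvr _ _ d1v)
    (fl _ _ (uncorrelatedT d2w) (uncorrelatedT d2z)) (Lvr _ _ (fl _ _ wv zv))).
  by rewrite !(mulmx0, mul0mx) !addr0.
pose r1 n := C *m d1 n t - z n t; pose s n := C *m d2 n t - v n t.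
have r1r1 : correlates r1 r1 (C *m SigmaD *m C^T + SigmaZ).
  have d1r1 : correlates (d1 ^~ t) r1 (SigmaD *m C^T - 0).
    by apply: correlatesBr => //; exact: correlatesMr.
  have zr1 : correlates (z ^~ t) r1 (0 *m C^T - SigmaZ).
    by apply: correlatesBr => //; apply: correlatesMr; exact: uncorrelatedT.
  have := correlatesBl (correlatesMl C d1r1) zr1.
  by rewrite subr0 mul0mx sub0r opprK mulmxA.
have r1s : correlates r1 s 0.
  apply: uncorrelatedDl; last apply: uncorrelatedNl.
    apply: uncorrelatedMl; apply: uncorrelatedDr; last exact: uncorrelatedNr.
    exact: uncorrelatedMr.
  apply: uncorrelatedDr; last exact: uncorrelatedNr.
  by apply: uncorrelatedMr; exact: uncorrelatedT.
have rs n : r n t = r1 n + s n by rewrite rE.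
(* With [r = r1 + s], the test makes [r] correlate with itself exactly as [r1] does with [r], so [s]
   is uncorrelated with [r]; subtracting [r1] leaves [s] with itself. *)
have s0 : correlates s s 0.
  have r1r : correlates r1 (r ^~ t) (C *m SigmaD *m C^T + SigmaZ + 0).
    apply: (@correlates_eq _ _ _ r1 _ (fun n => r1 n + s n)) => //.
    exact: correlatesDr.
  have sr : correlates s (r ^~ t) 0.
    have := correlatesBl rr r1r; rewrite addr0 subrr.
    by apply: correlates_eq => n //; rewrite rs addrC addKr.
  have := uncorrelatedDr sr (uncorrelatedNr (uncorrelatedT r1s)).
  by apply: correlates_eq => n //; rewrite rs addrC addKr.
have sE : average (fun n => energy (s n)) N @[N --> \oo] --> 0.
  have := mcvg_trace s0; rewrite mxtrace0; apply: cvg_trans; apply: near_eq_cvg.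
  by apply: nearW => N; rewrite energy_trace.
have SigmaS0 : SigmaS = 0.
  have s1 : correlates s (zeta ^~ t) 0 by exact: cauchy_schwarz_correlates sE (tame_bounded ts).
  have vs : correlates (v ^~ t) (zeta ^~ t) (C *m 0 + SigmaS).
    apply: (@correlates_eq _ _ _ (fun n => C *m xi n t + zeta n t) _ (zeta ^~ t)) => //.
    by apply: correlatesDl => //; exact: correlatesMl.
  have := mcvg_unique s1 (correlatesBl (correlatesMl C d2s) vs).
  by rewrite !mulmx0 !add0r => /esym/eqP; rewrite oppr_eq0 => /eqP.
have so0 : correlates (zeta ^~ t) (omega ^~ t) 0.
  by apply: correlates_eq (so 0%N) => // n; rewrite addn0.
have sko k : correlates (fun n => s (n + k)%N) (omega ^~ t) 0.
  apply: cauchy_schwarz_correlates (tame_bounded tom).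
  by apply: (@average_shift0 _ (fun n => energy (s n))) => // n; exact: energy_ge0.
have d2ko k : correlates (fun n => d2 (n + k.+1)%N t) (omega ^~ t) 0.
  elim: k => [|k IH].
    (* At lag one the recursion with [F] serves, as [v n] precedes the effect of [omega n]. At
       larger lags [v] does see [omega n] and has to be absorbed into [s]. *)
    apply: (@correlates_eq _ _ _ (fun n => F *m d2 n t + - (L *m v n t)) _ (omega ^~ t)) => //.
      by move=> n; rewrite addn1.
    apply: uncorrelatedDl; first exact: uncorrelatedMl.
    apply: uncorrelatedNl; apply: uncorrelatedMl; apply: uncorrelatedT.
    by apply: vr; exact: uncorrelatedT.
  (* [A] need not be stable here: only finitely many steps are taken. *)
  apply: (@correlates_eq _ _ _ (fun n => A *m d2 (n + k.+1)%N t + L *m s (n + k.+1)%N)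
    _ (omega ^~ t)) => //.
    move=> n; rewrite [in RHS]addnS /d2/= -/(d2 _ t) /s /F mulmxDl mulmxBr !mulmxA.
    by rewrite addrA.
  by apply: uncorrelatedDl; exact: uncorrelatedMl.
pose Mk k := iter k (mulmx M) 1%:M.
have xiko k : correlates (fun n => xi (n + k.+1)%N t) (omega ^~ t) (Mk k *m SigmaO).
  elim: k => [|k IH].
    apply: (@correlates_eq _ _ _ (fun n => M *m xi n t + omega n t) _ (omega ^~ t)) => //.
      by move=> n; rewrite addn1 hxi.
    have := correlatesDl (correlatesMl M xio) oo.
    by rewrite mulmx0 add0r /Mk/= mul1mx.
  apply: (@correlates_eq _ _ _ (fun n => M *m xi (n + k.+1)%N t + omega (n + k.+1)%N t)
    _ (omega ^~ t)) => //.
    by move=> n; rewrite [in RHS]addnS hxi.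
  have := correlatesDl (correlatesMl M IH) (uncorrelatedT (ook k)).
  by rewrite addr0 mulmxA.
have CMkO k : C *m (Mk k *m SigmaO) = 0.
  have vko : correlates (fun n => v (n + k.+1)%N t) (omega ^~ t) (C *m (Mk k *m SigmaO) + 0).
    apply: (@correlates_eq _ _ _ (fun n => C *m xi (n + k.+1)%N t + zeta (n + k.+1)%N t)
      _ (omega ^~ t)) => //.
    by apply: correlatesDl => //; exact: correlatesMl.
  have := mcvg_unique (sko k.+1) (correlatesBl (correlatesMl C (d2ko k)) vko).
  by rewrite mulmx0 addr0 sub0r => /esym/eqP; rewrite oppr_eq0 => /eqP.
have [Z ZE] := lyapunov_solution hK hK SigmaO.
have xixi : correlates (xi ^~ t) (xi ^~ t) Z.
  apply: (stable_correlates hK hK (hxi ^~ t) (hxi ^~ t) txi txi xio (uncorrelatedT xio) oo).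
  by rewrite mulmx0 mul0mx !add0r.
(* Unrolling the equation of the stationary covariance [Z] produces terms starting with
   [M ^ j SigmaO], all killed by [C]. The remainder vanishes as [k] grows, so [C Z = 0]. *)
have CZE k : C *m Z = C *m (Mk k *m Z *m (Mk k)^T).
  elim: k => [|k IH]; first by rewrite /Mk/= mul1mx trmx1 mulmx1.
  rewrite IH {1}ZE mulmxDr mulmxDl mulmxDr [C *m (Mk k *m SigmaO *m _)]mulmxA CMkO.
  rewrite mul0mx addr0 /Mk/= -/(Mk k) trmx_mul.
  by rewrite -(iter_mulmxC M k) -/(Mk k) -[in RHS]trmx_mul -iter_mulmxC -/(Mk k) trmx_mul !mulmxA.
have CZ : C *m Z = 0.
  apply: (@mcvg_unique _ _ _ (fun=> C *m Z)); first exact: mcvg_cst.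
  apply: (@mcvg_eq _ _ _ _ (fun=> C *m Z) 0 (fun k => esym (CZE k))).
  rewrite (_ : 0 = C *m (0 *m Z *m 0^T)); last by rewrite !(mul0mx, mulmx0).
  apply: mcvg_mulmxl; apply: mcvgM; last by apply: mcvg_tr; exact: schur_powers.
  by apply: mcvg_mulmxr; exact: schur_powers.
have vv : correlates (v ^~ t) (v ^~ t) 0.
  have vx : correlates (v ^~ t) (xi ^~ t) (C *m Z + 0).
    apply: (@correlates_eq _ _ _ (fun n => C *m xi n t + zeta n t) _ (xi ^~ t)) => //.
    by apply: correlatesDl; [exact: correlatesMl|exact: uncorrelatedT].
  have vs : correlates (v ^~ t) (zeta ^~ t) (C *m 0 + SigmaS).
    apply: (@correlates_eq _ _ _ (fun n => C *m xi n t + zeta n t) _ (zeta ^~ t)) => //.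
    by apply: correlatesDl => //; exact: correlatesMl.
  have := correlatesDr (correlatesMr C vx) vs.
  rewrite CZ SigmaS0 mulmx0 !addr0 mul0mx.
  by apply: correlates_eq => n //; rewrite /= vE.
have := mcvg_trace vv; rewrite mxtrace0; apply: cvg_trans; apply: near_eq_cvg.
by apply: nearW => N; rewrite energy_trace.
Unshelve. all: by end_near.
Qed.

End attacked_loop.

Theorem theorem1 (R : realType) (d : measure_display) (T : measurableType d)
  (P : probability T R) (p q m : nat)
  (A : 'M[R]_p) (B : 'M[R]_(p, q)) (C : 'M[R]_(m, p))
  (K : 'M[R]_(q, p)) (L : 'M[R]_(p, m))
  (SigmaW : 'M[R]_p) (SigmaZ : 'M[R]_m) (SigmaE : 'M[R]_q)
  (SigmaS : 'M[R]_m) (SigmaO : 'M[R]_p) (SigmaD : 'M[R]_p)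
  (alpha : R) (x0 xh0 xi0 : 'cV[R]_p)
  (w : nat -> T -> 'cV[R]_p) (z : nat -> T -> 'cV[R]_m)
  (e : nat -> T -> 'cV[R]_q)
  (zeta : nat -> T -> 'cV[R]_m) (omega : nat -> T -> 'cV[R]_p)
  (x xh xi : nat -> T -> 'cV[R]_p) (u : nat -> T -> 'cV[R]_q)
  (y v : nat -> T -> 'cV[R]_m) (k' : nat)
  (* noises *)
  (hw : iid_centered_gaussian P SigmaW w)
  (hz : iid_centered_gaussian P SigmaZ z)
  (he : iid_centered_gaussian P SigmaE e)
  (hzeta : iid_centered_gaussian P SigmaS zeta)
  (homega : iid_centered_gaussian P SigmaO omega)
  (hindep : mutually_independent P
     (tnth [tuple sigma_process w; sigma_process z; sigma_process e;
                  sigma_process zeta; sigma_process omega]))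
  (* plant, controller and attack *)
  (hx0 : forall t, x 0%N t = x0)
  (hx : forall n t, x n.+1 t = A *m x n t + B *m u n t + w n t)
  (hy : forall n t, y n t = C *m x n t + z n t + v n t)
  (hu : forall n t, u n t = K *m xh n t + e n t)
  (hxh0 : forall t, xh 0%N t = xh0)
  (hxh : forall n t, xh n.+1 t =
     (A + B *m K + L *m C) *m xh n t + B *m e n t - L *m y n t)
  (hxi0 : forall t, xi 0%N t = xi0)
  (hxi : forall n t, xi n.+1 t = (A + B *m K) *m xi n t + omega n t)
  (hv : forall n t, v n t =
     alpha *: (C *m x n t + z n t) + C *m xi n t + zeta n t)
  (* design assumptions *)
  (hK : schur_stable (A + B *m K))
  (hL : schur_stable (A + L *m C))
  (hSigmaD_psd : posdef_semi SigmaD)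
  (hSigmaD : SigmaD = (A + L *m C) *m SigmaD *m (A + L *m C)^T
                      + SigmaW + L *m SigmaZ *m L^T)
  (hAB : stabilizable A B)
  (hAC : detectable A C)
  (hSigmaE : \rank SigmaE = q)
  (hk' : C *m (A + B *m K) ^+ k' *m B <> 0)
  (hk'_min : forall k : nat, C *m (A + B *m K) ^+ k *m B <> 0 -> (k' <= k)%N)
  (* watermarking tests *)
  (htest1 : as_lim P
     (time_avg (fun n t => (C *m xh n t - y n t) *m (C *m xh n t - y n t)^T))
     (C *m SigmaD *m C^T + SigmaZ))
  (htest2 : as_lim P
     (time_avg (fun n t => (C *m xh n t - y n t) *m (delay k'.+1 e n t)^T))
     0) :
  as_lim P (time_avg (fun n t => (v n t)^T *m v n t)) 0.
Proof.
pose r n t := C *m xh n t - y n t.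
have test1 : {ae P, forall t,
    correlates (r ^~ t) (r ^~ t) (C *m SigmaD *m C^T + SigmaZ)}.
  apply: filterS htest1 => t /cvg_mcvg; apply: mcvg_eq => N.
  exact: cross_average_time_avg.
(* [alpha] is a constant, so the case split stays outside the almost sure statement. If it is
   nonzero, the two tests contradict each other almost everywhere and the claim follows there. *)
have [a0|a_neq0] := eqVneq alpha 0.
  have := stealthy_attack_power0 hw hz he hzeta homega hindep hx0 hx hy hu hxh0 hxh
    hxi0 hxi hv a0 hK hL hSigmaD.
  apply: filterS2 test1 => t rr /(_ rr) vE.
  apply: mcvg_cvg => i j; rewrite mxE; apply: cvg_trans vE.
  apply: near_eq_cvg; apply: nearW => N.
  rewrite /time_avg mxE summxE big_mkord /average; congr (_ * _).
  apply: eq_bigr => n _; rewrite !ord1 mxE /energy; apply: eq_bigr => k _.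
  by rewrite mxE expr2.
have test2 : {ae P, forall t, correlates (r ^~ t) (fun n => delay k'.+1 e n t) 0}.
  apply: filterS htest2 => t /cvg_mcvg; apply: mcvg_eq => N.
  exact: (@cross_average_time_avg R T m q r (delay k'.+1 e)).
have := watermark_gain_eq0 hw hz he hzeta homega hindep hx0 hx hy hu hxh0 hxh
  hxi0 hxi hv hk'_min (C *m SigmaD *m C^T + SigmaZ) hSigmaE hk'.
apply: filterS3 test1 test2 => t rr re /(_ rr re) a0.
by rewrite a0 eqxx in a_neq0.
Qed.
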